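(* Let $\mathcal{G}$ be a compact abelian group equipped with the normalised Haar measure $\eta$, and let $\Gamma$ be a group of continuous automorphisms of $\mathcal{G}$. Then $\eta$ is ergodic (with respect to the $\Gamma$-action on $\mathcal{G}$) if and only if every nontrivial character $\vartheta\in\mathcal{G}^{\circ}$ has an infinite $\Gamma$-orbit.
   Context: $\mathcal{G}^{\circ}$ denotes the Pontryagin dual of $\mathcal{G}$, on which $\Gamma$ acts by $(\gamma\cdot\vartheta)(x)=\vartheta(\gamma^{-1}\cdot x)$. The Haar probability measure $\eta$ is $\Gamma$-invariant, and it is called ergodic if $\eta(B)\in\{0,1\}$ for every $\Gamma$-invariant Borel set $B$ (equivalently, every $\Gamma$-invariant function in $L^2(\mathcal{G},\eta)$ is constant $\eta$-almost everywhere). *)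

(* Defs.v *)
From HB Require Import structures.
From mathcomp Require Import all_boot all_order all_algebra.
From mathcomp Require Import complex.
From mathcomp Require Import all_classical all_reals all_analysis.

Set Implicit Arguments.
Unset Strict Implicit.
Unset Printing Implicit Defensive.

Import Order.TTheory GRing.Theory Num.Theory.
Import numFieldNormedType.Exports.

Local Open Scope classical_set_scope.
Local Open Scope ring_scope.

(* The library's [g_sigma_algebraType] is a [measurableType] only over a
   [pointedType], which a [topologicalZmodType] is not; the chosen point, 0,
   plays no role. [borelType G] is convertible to [G]. *)
Definition zpointed (G : topologicalZmodType) : Type := G.
HB.instance Definition _ (G : topologicalZmodType) := Choice.on (zpointed G).
HB.instance Definition _ (G : topologicalZmodType) :=
  isPointed.Build (zpointed G) 0.

Definition borelType (G : topologicalZmodType) : Type :=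
  g_sigma_algebraType (@open G : set (set (zpointed G))).
HB.instance Definition _ (G : topologicalZmodType) :=
  Measurable.on (borelType G).

(* Regularity is part of the notion of Haar measure: when G is not metrizable,
   translation invariance alone need not determine a Borel probability. *)
Definition outer_regular (G : topologicalZmodType) (R : realType)
    (mu : probability (borelType G) R) : Prop :=
  forall A : set (borelType G), measurable A ->
    mu A = ereal_inf [set mu U | U in [set U : set G | open U /\ A `<=` U]].

Definition open_inner_regular (G : topologicalZmodType) (R : realType)
    (mu : probability (borelType G) R) : Prop :=
  forall U : set G, open U ->
    mu U = ereal_sup [set mu K | K in [set K : set G | compact K /\ K `<=` U]].

Definition translation_invariant (G : topologicalZmodType) (R : realType)
    (mu : probability (borelType G) R) : Prop :=
  forall (x : G) (A : set (borelType G)), measurable A ->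
    mu [set x + y | y in (A : set G)] = mu A.

Definition normalised_haar (G : topologicalZmodType) (R : realType)
    (mu : probability (borelType G) R) : Prop :=
  [/\ translation_invariant mu, outer_regular mu & open_inner_regular mu].

Record cAut (G : topologicalZmodType) := CAut {
  cAut_fun :> G -> G;
  cAut_inv : G -> G;
  cAut_funK : cancel cAut_fun cAut_inv;
  cAut_invK : cancel cAut_inv cAut_fun;
  cAut_add : {morph cAut_fun : x y / x + y};
  cAut_continuous : continuous cAut_fun;
  cAut_inv_continuous : continuous cAut_inv }.

HB.instance Definition _ (G : topologicalZmodType) := gen_eqMixin (cAut G).
HB.instance Definition _ (G : topologicalZmodType) := gen_choiceMixin (cAut G).

Section CAutGroup.
Variable G : topologicalZmodType.
Implicit Types g h : cAut G.

Lemma cAut_eq g h : cAut_fun g =1 cAut_fun h -> g = h.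
Proof.
case: g h => [f f' fK f'K fD fc f'c] [k k' kK k'K kD kc k'c] /= /funext fk.
subst k; have ff' : f' = k' by apply/funext => x; rewrite -{1}(k'K x) fK.
by subst k'; congr CAut; exact: Prop_irrelevance.
Qed.

Definition cAut_one : cAut G :=
  @CAut G id id (fun=> erefl) (fun=> erefl) (fun _ _ => erefl)
    (fun=> cvg_id) (fun=> cvg_id).

Lemma cAut_invD g : {morph cAut_inv g : x y / x + y}.
Proof.
by move=> x y; apply: (can_inj (cAut_funK g)); rewrite cAut_add !cAut_invK.
Qed.

Definition cAut_inverse g : cAut G :=
  CAut (@cAut_invK G g) (@cAut_funK G g) (@cAut_invD g)
    (@cAut_inv_continuous G g) (@cAut_continuous G g).

Lemma cAut_compD g h : {morph g \o h : x y / x + y}.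
Proof. by move=> x y /=; rewrite !cAut_add. Qed.

Lemma cAut_comp_continuous g h : continuous (g \o h).
Proof. by move=> x; apply: continuous_comp; exact: cAut_continuous. Qed.

Lemma cAut_comp_inv_continuous g h : continuous (cAut_inv h \o cAut_inv g).
Proof. by move=> x; apply: continuous_comp; exact: cAut_inv_continuous. Qed.

Definition cAut_comp g h : cAut G :=
  CAut (can_comp (@cAut_funK G g) (@cAut_funK G h))
    (can_comp (@cAut_invK G h) (@cAut_invK G g))
    (@cAut_compD g h) (@cAut_comp_continuous g h)
    (@cAut_comp_inv_continuous g h).

Lemma cAut_compA : associative cAut_comp.
Proof. by move=> g h k; exact: cAut_eq. Qed.

Lemma cAut_comp1g : left_id cAut_one cAut_comp.
Proof. by move=> g; exact: cAut_eq. Qed.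

Lemma cAut_compg1 : right_id cAut_one cAut_comp.
Proof. by move=> g; exact: cAut_eq. Qed.

Lemma cAut_compVg : left_inverse cAut_one cAut_inverse cAut_comp.
Proof. by move=> g; apply: cAut_eq => x /=; rewrite cAut_funK. Qed.

Lemma cAut_compgV : right_inverse cAut_one cAut_inverse cAut_comp.
Proof. by move=> g; apply: cAut_eq => x /=; rewrite cAut_invK. Qed.

HB.instance Definition _ := isGroup.Build (cAut G)
  cAut_compA cAut_comp1g cAut_compg1 cAut_compVg cAut_compgV.

End CAutGroup.

Definition is_subgroup (G : topologicalZmodType) (Gamma : set (cAut G)) : Prop :=
  group_closed [pred g in Gamma].

Definition invariant_set (G : topologicalZmodType) (Gamma : set (cAut G))
    (B : set G) : Prop :=
  forall g, Gamma g -> g @` B = B.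

Definition ergodic (G : topologicalZmodType) (R : realType)
    (Gamma : set (cAut G)) (mu : probability (borelType G) R) : Prop :=
  forall B : set (borelType G), measurable B -> invariant_set Gamma B ->
    mu B = 0%E \/ mu B = 1%E.

(* [R[i]^o] carries the topology of the modulus on R[i]. *)
Record pontryagin_dual (R : realType) (G : topologicalZmodType) := Character {
  char_fun :> G -> R[i];
  char_norm : forall x, `|char_fun x| = 1;
  char_mul : forall x y, char_fun (x + y) = char_fun x * char_fun y;
  char_continuous : continuous (char_fun : G -> R[i]^o) }.

Section DualAction.
Variables (R : realType) (G : topologicalZmodType).
Implicit Types (g : cAut G) (theta : pontryagin_dual R G).

Lemma trivial_char_norm (x : G) : `|1 : R[i]| = 1.
Proof. exact: normr1. Qed.

Lemma trivial_char_mul (x y : G) : (1 : R[i]) = 1 * 1.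
Proof. by rewrite mulr1. Qed.

Lemma trivial_char_continuous : continuous ((fun=> 1) : G -> R[i]^o).
Proof. by move=> x; exact: cvg_cst. Qed.

Definition trivial_char : pontryagin_dual R G :=
  @Character R G (fun=> 1) trivial_char_norm trivial_char_mul
    trivial_char_continuous.

Lemma act_char_norm g theta x : `|theta ((g^-1)%g x)| = 1.
Proof. exact: char_norm. Qed.

Lemma act_char_mul g theta x y :
  theta ((g^-1)%g (x + y)) = theta ((g^-1)%g x) * theta ((g^-1)%g y).
Proof. by rewrite cAut_add char_mul. Qed.

Lemma act_char_continuous g theta :
  continuous ((fun x => theta ((g^-1)%g x)) : G -> R[i]^o).
Proof.
move=> x; apply: (@continuous_comp _ _ _ (cAut_fun (g^-1)%g)).
  exact: cAut_continuous.
exact: char_continuous.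
Qed.

Definition act_char g theta : pontryagin_dual R G :=
  @Character R G (fun x => theta ((g^-1)%g x)) (act_char_norm g theta)
    (act_char_mul g theta) (act_char_continuous (g := g) (theta := theta)).

Definition char_orbit (Gamma : set (cAut G)) theta : set (pontryagin_dual R G) :=
  [set act_char g theta | g in Gamma].

End DualAction.

Arguments trivial_char : clear implicits.

(* Main.v *)
(* If a nontrivial character has a finite orbit, the points at which all characters of the
   orbit are close to 1 form an invariant open set, which is neither null nor conull.

   Conversely, let B be invariant and f = 1_B - eta(B). Then the Fourier coefficient of f
   is constant along orbits, so by Bessel's inequality it vanishes at every character with
   an infinite orbit, and it also vanishes at the trivial one. It remains to see that f = 0,
   i.e. that the Fourier transform is injective. If f <> 0, its autocorrelation h is
   continuous, positive-definite and nonzero with zero Fourier transform. Maximize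
   the squared norm of the correlation of h with q over the continuous positive-definite q
   with q(0) = 1; in terms of Fourier series this is to maximize sum |h^|^2 (q^)^2 over the
   probability weights q^, so a maximizer should be a single character. A limit (p, r) of
   almost maximizing pairs (q, corr h q) along an ultrafilter exists since the functions
   corr h q are equicontinuous. As 4 q is the sum of two positive-definite functions
   2 q + c q(. + y) + c^* q(. - y) and 2 q - c q(. + y) - c^* q(. - y), strict convexity
   forces r(x + y) = p(y) r(x), so that p is a character, and h^(p) <> 0.

   Riemann sums with nodes independent of the integrand replace Fubini's theorem, and also
   give the invariance of eta under automorphisms. *)

Require Import Defs.
From HB Require Import structures.
From mathcomp Require Import all_boot all_order all_algebra finmap.
From mathcomp Require Import complex.
From mathcomp Require Import all_classical all_reals all_analysis measurable_realfun.
From mathcomp Require Import ring lra.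

Set Implicit Arguments.
Unset Strict Implicit.
Unset Printing Implicit Defensive.

Import Order.TTheory GRing.Theory Num.Theory.
Import numFieldNormedType.Exports.
Import Normc.

Local Open Scope classical_set_scope.
Local Open Scope ring_scope.

Local Notation cRe := (@complex.Re _).
Local Notation cIm := (@complex.Im _).

(** * Complex-valued continuous functions on a compact group *)

Section ComplexModulus.
Variable R : rcfType.
Implicit Types (z w : R[i]) (a b : R).

Lemma normcE z : `|z| = (normc z)%:C%C. Proof. by []. Qed.

Lemma conjE z : z^* = (z^*)%C. Proof. by []. Qed.

Lemma normcD_le z w : normc (z + w) <= normc z + normc w.
Proof. exact: le_normcD. Qed.

Lemma normc_opp z : normc (- z) = normc z.
Proof. exact: normcN. Qed.

Lemma normcB z w : normc (z - w) = normc (w - z).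
Proof. by rewrite -normc_opp opprB. Qed.

Lemma normc_dist z1 z2 z3 : normc (z1 - z3) <= normc (z1 - z2) + normc (z2 - z3).
Proof. by rewrite (le_trans _ (normcD_le _ _))// addrA subrK. Qed.

Lemma normc_ge0 z : 0 <= normc z.
Proof. by case: z => a b; exact: sqrtr_ge0. Qed.

Lemma normc_real a : normc a%:C%C = `|a|.
Proof. by rewrite /= expr0n addr0 sqrtr_sqr. Qed.

Lemma normcJ_eq z : normc (z^*) = normc z.
Proof. by case: z => a b; rewrite -[_^*]/(_^*)%C /= sqrrN. Qed.

Lemma normRe_le z : `|complex.Re z| <= normc z.
Proof. by case: z => a b /=; rewrite -sqrtr_sqr ler_wsqrtr// lerDl sqr_ge0. Qed.

Lemma normIm_le z : `|complex.Im z| <= normc z.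
Proof. by case: z => a b /=; rewrite -sqrtr_sqr ler_wsqrtr// lerDr sqr_ge0. Qed.

Lemma normc_le z : normc z <= `|complex.Re z| + `|complex.Im z|.
Proof.
case: z => a b /=; rewrite -(@ler_sqr R) ?nnegrE ?sqrtr_ge0 ?addr_ge0//.
rewrite sqr_sqrtr ?addr_ge0 ?sqr_ge0// sqrrD !real_normK ?num_real//.
by rewrite lerD2r lerDl mulrn_wge0// mulr_ge0.
Qed.

Lemma ReD z w : complex.Re (z + w) = complex.Re z + complex.Re w.
Proof. by case: z; case: w. Qed.
Lemma ImD z w : complex.Im (z + w) = complex.Im z + complex.Im w.
Proof. by case: z; case: w. Qed.
Lemma ReM z w : complex.Re (z * w) =
  complex.Re z * complex.Re w - complex.Im z * complex.Im w.
Proof. by case: z; case: w. Qed.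
Lemma ImM z w : complex.Im (z * w) =
  complex.Re z * complex.Im w + complex.Im z * complex.Re w.
Proof. by case: z; case: w. Qed.
Lemma ReJ z : complex.Re z^* = complex.Re z.
Proof. by case: z. Qed.
Lemma ImJ z : complex.Im z^* = - complex.Im z.
Proof. by case: z. Qed.

Lemma mulJ_normc z : z * z^* = ((normc z) ^+ 2)%:C%C.
Proof. by rewrite -normCK normcE rmorphXn. Qed.

End ComplexModulus.

Section UniformContinuity.
Variables (R : realType) (G : topologicalZmodType).
Implicit Types (F : G -> R[i]).

(** Continuity for the modulus with real tolerances, so that all estimates stay in [R]; [ccontP]
    identifies it with the continuity required in [pontryagin_dual]. *)
Definition ccont F := forall x (e : R), 0 < e ->
  \forall y \near x, normc (F y - F x) < e.

Lemma ccontP F : ccont F <-> continuous (F : G -> R[i]^o).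
Proof.
split=> cF x.
  apply/cvgrPdist_lt => /= -[e e'] /[dup] e0; rewrite ltcE /= => /andP[/eqP ? e1]; subst e'.
  apply: filterS (cF x e e1) => y; rewrite normcB => h.
  by rewrite normcE -[Complex e 0]/(e%:C)%C ltcR.
move=> e e0; have /cvgrPdist_lt /= /(_ e%:C%C) := cF x.
by rewrite ltcR => /(_ e0); apply: filterS => y; rewrite normcE ltcR normcB.
Qed.

Lemma shift_near (x : G) (P : set G) : nbhs x P ->
  \forall y \near x & v \near (0 : G), P (y + v).
Proof.
move=> xP; have := @add_continuous G (x, 0 : G); rewrite /continuous_at /= addr0.
by move=> /(_ _ xP) [[A B] /= [xA B0] AB]; exists (A, B).
Qed.

Lemma near_sub (x : G) (P : set G) : nbhs 0 P -> \forall y \near x, P (y - x).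
Proof.
move=> P0; have := @sub_continuous G (x, x); rewrite /continuous_at /= subrr.
move=> /(_ _ P0) [[A B] /= [xA xB] AB]; apply: filterS xA => y Ay.
exact: AB (y, x) (conj Ay (nbhs_singleton xB)).
Qed.

Lemma addr_continuous (x : G) : continuous (fun y => y + x).
Proof.
move=> y; apply: (@continuous_comp _ _ _ (fun y => (y, x)) (fun p : G * G => p.1 + p.2)).
  by apply: cvg_pair => /=; [exact: cvg_id|exact: cvg_cst].
exact: add_continuous.
Qed.

Hypothesis Gc : compact [set: G].

(** Continuity of addition at [(x, 0)] gives the estimate on a neighbourhood of [x] times one of 0;
    the covering form of compactness makes it uniform in [x]. *)
Lemma ccont_unif F (e : R) : ccont F -> 0 < e ->
  \forall v \near (0 : G), forall x, normc (F (x + v) - F x) < e.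
Proof.
move=> cF e0.
have /compact_near_coveringP cov := Gc.
have h x : [set: G] x ->
    \forall x' \near x & v \near (0 : G), normc (F (x' + v) - F x') < e.
  move=> _; have e20 : 0 < e / 2 by rewrite divr_gt0.
  have h1 := cF x _ e20.
  have := shift_near h1; case=> -[A B] /= [xA B0] AB.
  exists (A `&` [set y | normc (F y - F x) < e / 2], B) => /=.
    by split => //; exact: filterI.
  move=> [y v] /= [[Ay Fy] Bv]; have /= := AB (y, v) (conj Ay Bv) => h2.
  apply: le_lt_trans (normc_dist _ (F x) _) _; rewrite (normcB (F x)).
  by rewrite [e]splitr ltrD.
have := cov _ _ (fun v x => normc (F (x + v) - F x) < e) (nbhs_filter (0 : G)) h.
by apply: filterS => v hv x; exact: hv.
Qed.

(** The covering argument of [ccont_unif], with bounds [k] tending to [+oo] in place of shifts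
    tending to 0. *)
Lemma ccont_bounded F : ccont F -> exists k : R, forall x, normc (F x) <= k.
Proof.
move=> cF; have /compact_near_coveringP cov := Gc.
have h x : [set: G] x ->
    \forall x' \near x & k \near +oo%R, normc (F x') <= k.
  move=> _; exists ([set y | normc (F y - F x) < 1], [set k | normc (F x) + 1 < k]).
    split; first exact: cF.
    by exists (normc (F x) + 1); split => //; exact: num_real.
  move=> [y k] /= [h1 h2]; rewrite -[F y](subrK (F x)).
  by have := normcD_le (F y - F x) (F x); lra.
have [k [_ /(_ (k + 1))]] := cov _ _ (fun k x => normc (F x) <= k)
  (@filter_filter R _ proper_pinfty_nbhs) h.
by rewrite ltrDl ltr01 => /(_ isT) hk; exists (k + 1) => x; exact: hk.
Qed.

Lemma ccontD F1 F2 : ccont F1 -> ccont F2 -> ccont (fun x => F1 x + F2 x).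
Proof.
move=> c1 c2 x e e0; have e2 : 0 < e / 2 by rewrite divr_gt0.
near=> y; have h1 : normc (F1 y - F1 x) < e / 2 by near: y; exact: c1.
have h2 : normc (F2 y - F2 x) < e / 2 by near: y; exact: c2.
rewrite opprD addrACA; have := normcD_le (F1 y - F1 x) (F2 y - F2 x); lra.
Unshelve. all: by end_near. Qed.

Lemma ccontM F1 F2 : ccont F1 -> ccont F2 -> ccont (fun x => F1 x * F2 x).
Proof.
move=> /ccontP c1 /ccontP c2; apply/ccontP => x.
by apply: (@cvgM R[i] G (nbhs x) _ F1 F2); [exact: c1|exact: c2].
Qed.

Lemma ccont_cst (z : R[i]) : ccont (fun=> z).
Proof. by move=> x e e0; near=> y; rewrite subrr normc0.
Unshelve. all: by end_near. Qed.

Lemma ccontJ F : ccont F -> ccont (fun x => (F x)^*).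
Proof.
by move=> cF x e e0; apply: filterS (cF x e e0) => y; rewrite -rmorphB normcJ_eq.
Qed.

Lemma ccont_comp (f : G -> G) F : continuous f -> ccont F -> ccont (F \o f).
Proof. by move=> cf cF x e e0; exact: (cf x _ (cF (f x) e e0)). Qed.

Lemma ccont_shift y F : ccont F -> ccont (fun x => F (x + y)).
Proof. by apply: (ccont_comp (f := fun x => x + y)); exact: addr_continuous. Qed.

Lemma ccont_opp F : ccont F -> ccont (fun x => F (- x)).
Proof. by apply: (ccont_comp (f := fun x => - x)); exact: opp_continuous. Qed.

Lemma ccont_open F (e : R) w : ccont F -> open [set x | normc (F x - w) < e].
Proof.
move=> cF; rewrite openE => x /= h; rewrite /interior.
have e0 : 0 < e - normc (F x - w) by rewrite subr_gt0.
apply: filterS (cF x _ e0) => y /= h2.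
by have := normc_dist (F y) (F x) w; lra.
Qed.

Lemma ccont_open_gt F (e : R) w : ccont F -> open [set x | e < normc (F x - w)].
Proof.
move=> cF; rewrite openE => x /= h; rewrite /interior.
have e0 : 0 < normc (F x - w) - e by rewrite subr_gt0.
apply: filterS (cF x _ e0) => y /= h2.
by have := normc_dist (F x) (F y) w; rewrite (normcB (F x) (F y)); lra.
Qed.

End UniformContinuity.

(** * Integration of bounded Borel functions *)

Section ComplexIntegral.
Variables (R : realType) (G : topologicalZmodType).
Variable eta : probability (borelType G) R.
Implicit Types (F : G -> R[i]) (g : G -> R).

(** Boundedness gives integrability, [eta] being finite, and unlike integrability it is stable under
    products. *)
Definition bmeas g := measurable_fun [set: borelType G] g /\
  exists k : R, forall x, `|g x| <= k.

Lemma bmeas_integrable g : bmeas g -> eta.-integrable setT (EFin \o g).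
Proof.
move=> [mg [k gk]]; apply: measurable_bounded_integrable => //.
  by rewrite (le_lt_trans (probability_le1 _ _))// ltry.
by exists k; split; [exact: num_real|move=> j kj x _; exact: le_trans (gk x) (ltW kj)].
Qed.

Lemma bmeas_cst (k : R) : bmeas (fun=> k).
Proof. by split; [exact: measurable_cst|exists `|k|]. Qed.

Lemma bmeasD g1 g2 : bmeas g1 -> bmeas g2 -> bmeas (fun x => g1 x + g2 x).
Proof.
move=> [m1 [k1 h1]] [m2 [k2 h2]]; split; first exact: measurable_funD.
by exists (k1 + k2) => x; rewrite (le_trans (ler_normD _ _))// lerD.
Qed.

Lemma bmeasM g1 g2 : bmeas g1 -> bmeas g2 -> bmeas (fun x => g1 x * g2 x).
Proof.
move=> [m1 [k1 h1]] [m2 [k2 h2]]; split; first exact: measurable_funM.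
by exists (k1 * k2) => x; rewrite normrM ler_pM.
Qed.

Lemma bmeasN g : bmeas g -> bmeas (fun x => - g x).
Proof.
move=> mg; rewrite (_ : (fun x => _) = (fun x => -1 * g x)).
  by apply: bmeasM => //; exact: bmeas_cst.
by apply/funext => x; rewrite mulN1r.
Qed.

Lemma bmeas_indic (A : set (borelType G)) : measurable A -> bmeas (\1_A : G -> R).
Proof.
move=> mA; split; first exact: measurable_indic.
by exists 1 => x; rewrite indicE; case: (x \in A); rewrite ?normr1 ?normr0.
Qed.

Definition rint g : R := Rintegral eta setT g.

Lemma rintD g1 g2 : bmeas g1 -> bmeas g2 ->
  rint (fun x => g1 x + g2 x) = rint g1 + rint g2.
Proof. by move=> b1 b2; apply: RintegralD => //; exact: bmeas_integrable. Qed.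

Lemma rintZ (k : R) g : bmeas g -> rint (fun x => k * g x) = k * rint g.
Proof. by move=> b; apply: RintegralZl => //; exact: bmeas_integrable. Qed.

Lemma rint_cst (k : R) : rint (fun=> k) = k.
Proof. by rewrite /rint Rintegral_cst//; have /= -> := probability_setT eta; rewrite mulr1. Qed.

Lemma rint_le g1 g2 : bmeas g1 -> bmeas g2 -> (forall x, g1 x <= g2 x) ->
  rint g1 <= rint g2.
Proof.
by move=> b1 b2 le; apply: le_Rintegral => //; exact: bmeas_integrable.
Qed.

Lemma rintN g : bmeas g -> rint (fun x => - g x) = - rint g.
Proof.
move=> b; rewrite -mulN1r -rintZ//; congr rint.
by apply/funext => x; rewrite mulN1r.
Qed.

Lemma rint_norm_le g1 g2 : bmeas g1 -> bmeas g2 -> (forall x, `|g1 x| <= g2 x) ->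
  `|rint g1| <= rint g2.
Proof.
move=> b1 b2 le; rewrite ler_norml -rintN//; apply/andP; split; apply: rint_le => //.
- exact: bmeasN.
- by move=> x; have := le x; rewrite ler_norml => /andP[].
- by move=> x; have := le x; rewrite ler_norml => /andP[].
Qed.

Lemma rint_indic (A : set (borelType G)) : measurable A ->
  rint (\1_A) = fine (eta A).
Proof. by move=> mA; rewrite /rint /Rintegral integral_indic// setIT. Qed.

Definition cmeas F := bmeas (cRe \o F) /\ bmeas (cIm \o F).

Definition cint F : R[i] := Complex (rint (cRe \o F)) (rint (cIm \o F)).

Lemma cmeas_cst (z : R[i]) : cmeas (fun=> z).
Proof. by split; exact: bmeas_cst. Qed.

Lemma cmeasD F1 F2 : cmeas F1 -> cmeas F2 -> cmeas (fun x => F1 x + F2 x).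
Proof.
move=> [r1 i1] [r2 i2]; split.
  rewrite (_ : _ \o _ = fun x => complex.Re (F1 x) + complex.Re (F2 x)).
    exact: bmeasD.
  by apply/funext => x /=; rewrite ReD.
rewrite (_ : _ \o _ = fun x => complex.Im (F1 x) + complex.Im (F2 x)).
  exact: bmeasD.
by apply/funext => x /=; rewrite ImD.
Qed.

Lemma cmeasM F1 F2 : cmeas F1 -> cmeas F2 -> cmeas (fun x => F1 x * F2 x).
Proof.
move=> [r1 i1] [r2 i2]; split.
  rewrite (_ : _ \o _ = fun x => complex.Re (F1 x) * complex.Re (F2 x) +
    - (complex.Im (F1 x) * complex.Im (F2 x))).
    by apply: bmeasD; [exact: bmeasM|apply: bmeasN; exact: bmeasM].
  by apply/funext => x /=; rewrite ReM.
rewrite (_ : _ \o _ = fun x => complex.Re (F1 x) * complex.Im (F2 x) +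
    complex.Im (F1 x) * complex.Re (F2 x)).
  by apply: bmeasD; exact: bmeasM.
by apply/funext => x /=; rewrite ImM.
Qed.

Lemma cmeasZ (z : R[i]) F : cmeas F -> cmeas (fun x => z * F x).
Proof. by apply: cmeasM; exact: cmeas_cst. Qed.

Lemma cmeasJ F : cmeas F -> cmeas (fun x => (F x)^*).
Proof.
move=> [r i]; split.
  rewrite (_ : _ \o _ = cRe \o F)//.
  by apply/funext => x /=; rewrite ReJ.
rewrite (_ : _ \o _ = fun x => - complex.Im (F x)); first exact: bmeasN.
by apply/funext => x /=; rewrite ImJ.
Qed.

Lemma cmeas_real g : bmeas g -> cmeas (fun x => (g x)%:C%C).
Proof. by move=> b; split => //; exact: bmeas_cst. Qed.

Lemma cmeas_sum (I : Type) (r : seq I) (F : I -> G -> R[i]) :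
  (forall i, cmeas (F i)) -> cmeas (fun x => \sum_(i <- r) F i x).
Proof.
move=> mF; elim: r => [|i r ih].
  rewrite (_ : (fun x => _) = fun=> 0); first exact: cmeas_cst.
  by apply/funext => x; rewrite big_nil.
rewrite (_ : (fun x => _) = fun x => F i x + \sum_(i <- r) F i x).
  exact: cmeasD.
by apply/funext => x; rewrite big_cons.
Qed.

Lemma cintD F1 F2 : cmeas F1 -> cmeas F2 ->
  cint (fun x => F1 x + F2 x) = cint F1 + cint F2.
Proof.
move=> [r1 i1] [r2 i2]; rewrite /cint; apply/eqP; rewrite eq_complex /=.
rewrite -!rintD//; apply/andP; split; apply/eqP; congr rint; apply/funext => x /=.
  by rewrite ReD.
by rewrite ImD.
Qed.

Lemma cintZ (z : R[i]) F : cmeas F -> cint (fun x => z * F x) = z * cint F.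
Proof.
move=> [r i]; rewrite /cint; apply/eqP; rewrite eq_complex ReM ImM /=.
have b k g : bmeas g -> bmeas (fun x => k * g x).
  by move=> ?; apply: bmeasM => //; exact: bmeas_cst.
rewrite -!rintZ// -rintN -?rintD; do ?[exact: b|apply: bmeasN].
by apply/andP; split; apply/eqP; congr rint; apply/funext => x /=; rewrite ?ReM ?ImM.
Qed.

Lemma cintZr (z : R[i]) F : cmeas F -> cint (fun x => F x * z) = cint F * z.
Proof.
move=> mF; rewrite mulrC -cintZ//; congr cint.
by apply/funext => x; rewrite mulrC.
Qed.

Lemma cint_cst (z : R[i]) : cint (fun=> z) = z.
Proof. by case: z => a b; rewrite /cint /comp /= !rint_cst. Qed.

Lemma cintJ F : cmeas F -> cint (fun x => (F x)^*) = (cint F)^*.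
Proof.
move=> [r i]; apply/eqP; rewrite eq_complex ReJ ImJ /= -rintN//.
by apply/andP; split; apply/eqP; congr rint; apply/funext => x /=; rewrite ?ReJ ?ImJ.
Qed.

Lemma cintB F1 F2 : cmeas F1 -> cmeas F2 ->
  cint (fun x => F1 x - F2 x) = cint F1 - cint F2.
Proof.
move=> m1 m2; rewrite -mulN1r -cintZ// -cintD//; last exact: cmeasZ.
by congr cint; apply/funext => x; rewrite mulN1r.
Qed.

Lemma cmeasB F1 F2 : cmeas F1 -> cmeas F2 -> cmeas (fun x => F1 x - F2 x).
Proof.
move=> m1 m2; rewrite (_ : (fun x => _) = fun x => F1 x + -1 * F2 x).
  by apply: cmeasD => //; exact: cmeasZ.
by apply/funext => x; rewrite mulN1r.
Qed.

Lemma cint_sum (I : Type) (r : seq I) (F : I -> G -> R[i]) :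
  (forall i, cmeas (F i)) ->
  cint (fun x => \sum_(i <- r) F i x) = \sum_(i <- r) cint (F i).
Proof.
move=> mF; elim: r => [|i r ih].
  rewrite big_nil -[RHS]cint_cst; congr cint.
  by apply/funext => x; rewrite big_nil.
rewrite big_cons -ih -cintD//; last exact: cmeas_sum.
by congr cint; apply/funext => x; rewrite big_cons.
Qed.

Lemma cint_real g : cint (fun x => (g x)%:C%C) = (rint g)%:C%C.
Proof. by rewrite /cint /comp /= rint_cst. Qed.

Lemma cint_ge0 F : cmeas F -> (forall x, 0 <= F x) -> 0 <= cint F.
Proof.
move=> [r i] F0; rewrite lecE /=; apply/andP; split.
  apply/eqP; rewrite -[RHS](rint_cst 0); congr rint; apply/funext => x /=.
  by have := F0 x; rewrite lecE => /andP[/eqP].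
rewrite -[X in X <= _](rint_cst 0); apply: rint_le => //; first exact: bmeas_cst.
by move=> x /=; have := F0 x; rewrite lecE => /andP[].
Qed.

(** The factor 2 comes from estimating the real and the imaginary part separately; it recurs in the
    later bounds on integrals. *)
Lemma cint_norm_le F g : cmeas F -> bmeas g ->
  (forall x, normc (F x) <= g x) -> normc (cint F) <= 2 * rint g.
Proof.
move=> [r i] bg Fg; rewrite (le_trans (normc_le _))//= [2 * _]mulr_natl mulr2n.
by apply: lerD; apply: rint_norm_le => // x;
  rewrite (le_trans _ (Fg x))// ?normRe_le ?normIm_le.
Qed.

Lemma cint_norm_le_cst F (k : R) : cmeas F ->
  (forall x, normc (F x) <= k) -> normc (cint F) <= 2 * k.
Proof.
move=> mF Fk; rewrite -[k in leRHS](rint_cst k); apply: cint_norm_le => //.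
exact: bmeas_cst.
Qed.

(** The second hypothesis says that [eta] is its own pushforward along [f]. Translations and
    automorphisms are both treated this way. *)
Lemma cint_comp (f : G -> G) F :
  measurable_fun [set: borelType G] (f : borelType G -> borelType G) ->
  (forall A : set (borelType G), measurable A -> eta (f @^-1` A) = eta A) ->
  cmeas F -> cmeas (F \o f) /\ cint (F \o f) = cint F.
Proof.
move=> mf fE.
have key g : bmeas g -> bmeas (g \o f) /\ rint (g \o f) = rint g.
  move=> bg; have bgf : bmeas (g \o f).
    have [mg [k gk]] := bg; split; last by exists k => x; exact: gk.
    exact: (measurableT_comp mg mf).
  split => //; rewrite /rint /Rintegral; congr fine.
  have mEg : measurable_fun [set: borelType G] (EFin \o g).
    by apply/measurable_EFinP; case: bg.
  have /= <- := @integral_pushforward _ _ (borelType G) (borelType G) R f mf eta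
    setT (EFin \o g) mEg (bmeas_integrable bgf) measurableT.
  apply: eq_measure_integral => A mA _; exact: fE.
move=> [r i]; have [r1 r2] := key _ r; have [i1 i2] := key _ i; split=> //.
by rewrite /cint; congr Complex.
Qed.

Hypothesis Gc : compact [set: G].

Lemma open_borel (U : set G) : open U -> measurable (U : set (borelType G)).
Proof. by move=> oU; exact: sub_sigma_algebra. Qed.

Lemma continuous_borel (f : G -> G) : continuous f ->
  measurable_fun [set: borelType G] (f : borelType G -> borelType G).
Proof.
move=> cf; apply: (@measurability _ _ (borelType G) (borelType G) setT f (@open G)) => //.
move=> _ [U oU <-]; rewrite setTI; apply: open_borel.
by apply: open_comp => // x _; exact: cf.
Qed.

(** The rays []a, +oo[] generate the Borel sets of the line, so lower semicontinuity suffices. *)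
Lemma open_bmeas g (k : R) : (forall x, `|g x| <= k) ->
  (forall a, open [set x | a < g x]) -> bmeas g.
Proof.
move=> gk og; split; last by exists k.
apply: (@measurability _ _ (borelType G) R _ g _ (RGenOInfty.measurableE R)).
move=> _ [_ [a ->] <-]; rewrite setTI; apply: open_borel.
have <- : [set x | a < g x] = g @^-1` `]a, +oo[.
  by apply/seteqP; split=> x /=; rewrite in_itv /= andbT.
exact: og.
Qed.

Lemma ccont_cmeas F : ccont F -> cmeas F.
Proof.
move=> cF; have [k Fk] := ccont_bounded Gc cF.
have near_open (p : R[i] -> R) (a : R) :
    (forall z w, p z - p w <= normc (z - w)) -> open [set x | a < p (F x)].
  move=> plip; rewrite openE => x /= h; rewrite /interior.
  have e0 : 0 < p (F x) - a by rewrite subr_gt0.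
  apply: filterS (cF x _ e0) => y /=; have := plip (F x) (F y).
  by rewrite normcB; lra.
split; apply: (@open_bmeas _ k).
- by move=> x; rewrite (le_trans (normRe_le _)).
- move=> a; apply: (near_open cRe) => z w.
  rewrite (le_trans _ (normRe_le _))// (le_trans _ (ler_norm _))//.
  by rewrite ReD; case: w => ? ?.
- by move=> x; rewrite (le_trans (normIm_le _)).
- move=> a; apply: (near_open cIm) => z w.
  rewrite (le_trans _ (normIm_le _))// (le_trans _ (ler_norm _))//.
  by rewrite ImD; case: w => ? ?.
Qed.

End ComplexIntegral.

(** * Riemann sums for the Haar measure *)

(* The finite-cover form of compactness is only available for pointed spaces. *)
HB.instance Definition _ (G : topologicalZmodType) :=
  Topological.on (zpointed G).

Section HaarIntegral.
Variables (R : realType) (G : topologicalZmodType).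
Hypothesis Gc : compact [set: G].
Variable eta : probability (borelType G) R.
Hypothesis eta_inv : translation_invariant eta.
Implicit Types (F : G -> R[i]) (g : G -> R).
Local Notation cint := (cint eta).
Local Notation rint := (rint eta).

Lemma probE (A : set (borelType G)) : measurable A -> eta A = (rint (\1_A))%:E.
Proof. by move=> mA; rewrite rint_indic// fineK// fin_num_measure. Qed.

Lemma shift_invariant x (A : set (borelType G)) : measurable A ->
  eta ((fun y : G => y + x) @^-1` A) = eta A.
Proof.
move=> mA; rewrite -(eta_inv (- x) mA); congr (eta _).
apply/seteqP; split=> y /=; first by exists (y + x) => //; rewrite addrC addrK.
by move=> [z Az <-]; rewrite addrC addrA subrr add0r.
Qed.

Lemma cmeas_shift x F : cmeas F -> cmeas (fun y => F (y + x)).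
Proof.
move=> mF; apply: (proj1 (cint_comp (f := fun y => y + x) _ _ mF)).
  by apply: continuous_borel => //; exact: addr_continuous.
exact: shift_invariant.
Qed.

Lemma cint_shift x F : cmeas F -> cint (fun y => F (y + x)) = cint F.
Proof.
move=> mF; apply: (proj2 (cint_comp (f := fun y => y + x) _ _ mF)).
  by apply: continuous_borel => //; exact: addr_continuous.
exact: shift_invariant.
Qed.

Lemma shift_open x (U : set G) : open U -> open ((fun y : G => y + x) @^-1` U).
Proof. by move=> oU; apply: open_comp => // y _; exact: addr_continuous. Qed.

(** Compactness applied to the cover by all translates of [U]. The centres form a sequence so that
    the translates can later be made disjoint by [seqDU]. *)
Lemma finite_translates (U : set G) : open U -> U 0 ->
  exists s : seq G, forall y, exists2 i, (i < size s)%N & U (y - s`_i).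
Proof.
move=> oU U0; have : cover_compact [set: zpointed G] by rewrite -compact_cover; exact: Gc.
move=> /(_ G setT (fun x => (fun y => y - x) @^-1` U)).
case=> [x _|y _|D _ cov]; first exact: shift_open.
  by exists y => //=; rewrite subrr.
exists (enum_fset D) => y; have [x /= xD Uyx] := cov y I.
by exists (index x (enum_fset D)); rewrite ?index_mem// nth_index.
Qed.

Lemma rint_sum (I : Type) (r : seq I) (h : I -> G -> R) :
  (forall i, bmeas (h i)) ->
  bmeas (fun x => \sum_(i <- r) h i x) /\
  rint (fun x => \sum_(i <- r) h i x) = \sum_(i <- r) rint (h i).
Proof.
move=> mh; elim: r => [|i r [ih1 ih2]].
  rewrite big_nil (_ : (fun x => _) = fun=> 0); last first.
    by apply/funext => x; rewrite big_nil.
  by split; [exact: bmeas_cst|rewrite rint_cst].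
rewrite big_cons (_ : (fun x => _) = fun x => h i x + \sum_(i <- r) h i x).
  by rewrite -ih2 rintD//; split=> //; exact: bmeasD.
by apply/funext => x; rewrite big_cons.
Qed.

(** Finitely many translates of [U] cover the group, and all have the measure of [U]; if it were 0,
    the whole group would be null. *)
Lemma open_measure_gt0 (U : set G) : open U -> U !=set0 ->
  0 < rint (\1_U).
Proof.
(* The translate of [U] by [- u] contains 0. *)
move=> oU [u Uu]; have oV := shift_open u oU.
have [s scov] := finite_translates oV (eq_ind_r U Uu (add0r u)).
set V := (X in open X) in oV; pose A x := (fun y : G => y - x) @^-1` V.
have mA x : bmeas (\1_(A x) : G -> R).
  by apply: bmeas_indic; apply: open_borel; exact: shift_open.
have AE x : rint (\1_(A x)) = rint (\1_U).
  have mU : measurable (U : set (borelType G)) by exact: open_borel.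
  rewrite !rint_indic//; last by apply: open_borel; exact: shift_open.
  rewrite -[in RHS](shift_invariant (u - x) mU); congr (fine (eta _)).
  by apply/seteqP; split => y; rewrite /A /V /= [u - x]addrC addrA.
have [bs rs] := rint_sum (index_enum 'I_(size s)) (fun i => mA s`_i).
have : rint (fun=> 1) <= rint (fun x => \sum_(i < size s) \1_(A s`_i) x).
  apply: rint_le => // [|y]; first exact: bmeas_cst.
  have [i si Vi] := scov y; rewrite (bigD1 (Ordinal si))//=.
  have AVi : A s`_i y by exact: Vi.
  by rewrite indicE mem_set// lerDl sumr_ge0.
rewrite rint_cst rs; under eq_bigr do rewrite AE.
rewrite sumr_const.
have : 0 <= rint (\1_U).
  rewrite -[X in X <= _](rint_cst eta 0); apply: rint_le.
  - exact: bmeas_cst.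
  - by apply: bmeas_indic; exact: open_borel.
  - by move=> y; rewrite indicE ler0n.
rewrite le_eqVlt => /orP[/eqP<-|//]; rewrite mul0rn; lra.
Qed.

(* The nodes and weights depend on [V] only, hence serve all [F] at once. *)
Lemma riemann_sum (V : set G) : nbhs 0 V ->
  exists n (x : 'I_n -> G) (c : 'I_n -> R),
    forall F (e : R), cmeas F ->
      (forall y v, V v -> normc (F (y + v) - F y) <= e) ->
      normc (cint F - \sum_(i < n) (c i)%:C%C * F (x i)) <= 2 * e.
Proof.
move=> V0; have oU := @open_interior _ V.
have [s scov] := finite_translates oU (nbhs_singleton (nbhs_interior V0)).
(* Beyond the length of [s] the centres are the default 0, but only indices below [size s] enter the
   sums. *)
pose A i := (fun y : G => y - s`_i) @^-1` (interior V).
have mP i : measurable (seqDU A i : set (borelType G)).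
  by apply: seqDU_measurable => j; by apply: open_borel; exact: shift_open.
exists (size s), (fun i => s`_i), (fun i => rint (\1_(seqDU A i))) => F e mF Fe.
(* The step function whose value on each disjoint piece is [F] at the node: its integral is the
   Riemann sum, and it stays within [e] of [F]. *)
pose S y := \sum_(i < size s) (\1_(seqDU A i) y)%:C%C * F s`_i.
have mS (i : 'I_(size s)) : cmeas (fun y => (\1_(seqDU A i) y)%:C%C * F s`_i).
  apply: cmeasM; last exact: cmeas_cst.
  by apply: cmeas_real; exact: bmeas_indic.
have -> : \sum_(i < size s) (rint (\1_(seqDU A i)))%:C%C * F s`_i = cint S.
  rewrite cint_sum//; apply: eq_bigr => i _.
  rewrite cintZr ?cint_real//; by apply: cmeas_real; exact: bmeas_indic.
have mSS : cmeas S by exact: cmeas_sum.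
rewrite -cintB//; apply: cint_norm_le_cst; first exact: cmeasB.
move=> y; have [i si Ai] : exists2 i, (i < size s)%N & seqDU A i y.
  have : (\big[setU/set0]_(k < size s) A k) y.
    have [i si Ui] := scov y; rewrite -bigcup_mkord; exists i => //.
  by rewrite bigsetU_seqDU -bigcup_mkord => -[i /= si Ai]; exists i.
have -> : S y = F s`_i.
  rewrite /S (bigD1 (Ordinal si))//= indicE mem_set// mul1r big1 ?addr0// => j ji.
  rewrite indicE memNset ?mul0r// => Aj; move/eqP : ji; apply; apply/val_inj => /=.
  apply: (@trivIset_seqDU _ A) => //; by exists y.
have := subset_seqDU Ai; rewrite /A /= => /interior_subset Vi.
by have := Fe s`_i _ Vi; rewrite [s`_i + _]addrC subrK.
Qed.

Lemma small_eq0 (z : R[i]) (k : R) : (forall e, 0 < e -> normc z <= k * e) -> z = 0.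
Proof.
move=> h; apply: eq0_normc; apply/eqP; rewrite eq_le normc_ge0 andbT.
apply/ler_addgt0Pr => e e0; rewrite add0r.
have k0 : 0 < `|k| + 1 by rewrite ltr_wpDl.
apply: le_trans (h (e / (`|k| + 1)) _) _; first by rewrite divr_gt0.
rewrite mulrCA ger_pMr// ler_pdivrMr// mul1r.
by rewrite (le_trans (ler_norm _))// lerDl.
Qed.

(** If [F x] is nonzero, then [|F|] exceeds half of [|F x|] on a nonempty open set, which has
    positive measure. *)
Lemma cint_sqr_eq0 F : ccont F -> cint (fun x => F x * (F x)^*) = 0 ->
  forall x, F x = 0.
Proof.
move=> cF; rewrite (_ : (fun x => _) = fun x => ((normc (F x)) ^+ 2)%:C%C); last first.
  by apply/funext => x; rewrite mulJ_normc.
rewrite cint_real => -[r0] x; apply: contrapT => /eqP Fx0.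
have Fx : 0 < normc (F x).
  by rewrite lt_neqAle normc_ge0 andbT eq_sym; apply: contra Fx0 => /eqP /eq0_normc/eqP.
set e := normc (F x) / 2; have e0 : 0 < e by rewrite divr_gt0.
have oU := ccont_open_gt e 0 cF.
have Ux : [set x | e < normc (F x - 0)] x by rewrite /= subr0 /e; lra.
have := open_measure_gt0 oU (ex_intro _ x Ux); set U := [set x | _] => U0.
have mU : bmeas (\1_U : G -> R) by apply: bmeas_indic; exact: open_borel.
have mZ : bmeas (fun x => e ^+ 2 * \1_U x).
  by apply: bmeasM => //; exact: bmeas_cst.
have m2 : bmeas (fun x => (normc (F x)) ^+ 2).
  have [+ _] := cmeasM (ccont_cmeas Gc cF) (cmeasJ (ccont_cmeas Gc cF)).
  by congr bmeas; apply/funext => y /=; rewrite mulJ_normc.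
have : rint (fun x => e ^+ 2 * \1_U x) <= 0.
  rewrite -r0; apply: rint_le => // y; rewrite indicE.
  have [Uy|_] := boolP (y \in U); last by rewrite mulr0 sqr_ge0.
  rewrite mulr1 lerXn2r// ?nnegrE ?normc_ge0 ?ltW//.
  by move: Uy; rewrite inE /U /= subr0.
rewrite rintZ// leNgt mulr_gt0// exprn_gt0//.
Qed.

(** The approximation is tested on the constant 1, whose oscillation is 0. *)
Lemma riemann_sum1 n (x : 'I_n -> G) (c : 'I_n -> R) (V : set G) :
  (forall F (e : R), cmeas F ->
      (forall y v, V v -> normc (F (y + v) - F y) <= e) ->
      normc (cint F - \sum_(i < n) (c i)%:C%C * F (x i)) <= 2 * e) ->
  \sum_(i < n) (c i)%:C%C = 1.
Proof.
move=> /(_ (fun=> 1) 0 (cmeas_cst _ _)); rewrite cint_cst => h.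
have : normc (1 - \sum_(i < n) (c i)%:C%C * 1) <= 2 * 0.
  by apply: h => y v _; rewrite subrr normc0.
under eq_bigr do rewrite mulr1.
rewrite mulr0 => h0; apply/esym/eqP; rewrite -subr_eq0; apply/eqP/eq0_normc/eqP.
by rewrite eq_le h0 normc_ge0.
Qed.

Lemma cAutD (s : cAut G) x y : s (x + y) = s x + s y.
Proof. exact: cAut_add. Qed.

Lemma ccont_aut (s : cAut G) F : ccont F -> ccont (F \o s).
Proof. by apply: ccont_comp; exact: cAut_continuous. Qed.

(** The argument for uniqueness of Haar measure. The Riemann sums of all translates of [F]
    approximate the same integral; averaging over the translates by [s w] turns each term into a
    translate of [F \o s], and the weights add up to 1. *)
Lemma cint_aut_ccont (s : cAut G) F : ccont F -> cint (F \o s) = cint F.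
Proof.
move=> cF; apply/eqP; rewrite -subr_eq0; apply/eqP; apply: (@small_eq0 _ 4) => e e0.
have [n [x [c h]]] := riemann_sum (ccont_unif Gc cF e0).
have c1 := riemann_sum1 h.
have mF := ccont_cmeas Gc cF.
have mFs := ccont_cmeas Gc (ccont_aut s cF).
(* The nodes and weights serve every translate of [F] at once, and translation changes neither its
   integral nor its oscillation. *)
have S z : normc (cint F - \sum_(i < n) (c i)%:C%C * F (x i + z)) <= 2 * e.
  rewrite -(cint_shift z mF); apply: h; first exact: cmeas_shift.
  by move=> y v hv; rewrite addrAC; exact/ltW/hv.
have FE i w : F (x i + s w) = (F \o s) (w + cAut_inv s (x i)).
  by rewrite /= cAutD cAut_invK addrC.
have mi i : cmeas (fun w => (c i)%:C%C * F (x i + s w)).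
  apply: cmeasZ; rewrite (_ : (fun w => _) = fun w => (F \o s) (w + cAut_inv s (x i))).
    exact: cmeas_shift.
  by apply/funext => w; rewrite FE.
(* As a function of [w], each summand is a translate of [F \o s] by the preimage of [x i]. *)
have -> : cint (F \o s) = cint (fun w => \sum_(i < n) (c i)%:C%C * F (x i + s w)).
  rewrite cint_sum//.
  rewrite (eq_bigr (fun i => (c i)%:C%C * cint (F \o s))); last first.
    move=> i _; rewrite cintZ; last first.
      rewrite (_ : (fun w => _) = fun w => (F \o s) (w + cAut_inv s (x i))).
        exact: cmeas_shift.
      by apply/funext => w; rewrite FE.
    rewrite -(cint_shift (cAut_inv s (x i)) mFs).
    by congr (_ * cint _); apply/funext => w; rewrite FE.
  by rewrite -mulr_suml c1 mul1r.
rewrite -[cint F](cint_cst eta) -cintB//; [|exact: cmeas_sum|exact: cmeas_cst].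
have -> : 4 * e = 2 * (2 * e) by ring.
apply: cint_norm_le_cst; last by move=> w; rewrite normcB.
by apply: cmeasB; [exact: cmeas_sum|exact: cmeas_cst].
Qed.

(** Both iterated integrals are compared with [S], the Riemann sum in [z] of the inner integrals.
    Each is within [4 * e] of it: one factor 2 is from [riemann_sum], the other from integrating a
    bound in [y]. *)
Lemma cint_exchange (k : G -> G -> R[i]) :
  (forall z, cmeas (k z)) -> (forall y, cmeas (fun z => k z y)) ->
  cmeas (fun z => cint (k z)) -> cmeas (fun y => cint (fun z => k z y)) ->
  (forall e : R, 0 < e ->
    \forall v \near (0 : G), forall z y, normc (k (z + v) y - k z y) <= e) ->
  cint (fun z => cint (k z)) = cint (fun y => cint (fun z => k z y)).
Proof.
move=> mk1 mk2 m1 m2 kunif.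
apply/eqP; rewrite -subr_eq0; apply/eqP; apply: (@small_eq0 _ 8) => e e0.
have [n [x [c h]]] := riemann_sum (kunif e e0).
set S := \sum_(i < n) (c i)%:C%C * cint (k (x i)).
have h1 : normc (cint (fun z => cint (k z)) - S) <= 4 * e.
  have -> : 4 * e = 2 * (2 * e) by ring.
  apply: h => // z v hv; rewrite -cintB//.
  apply: cint_norm_le_cst; first exact: cmeasB.
  by move=> y; exact: hv.
have ms i : cmeas (fun y => (c i)%:C%C * k (x i) y) by exact: cmeasZ.
have h2 : normc (cint (fun y => cint (fun z => k z y)) - S) <= 4 * e.
  have -> : S = cint (fun y => \sum_(i < n) (c i)%:C%C * k (x i) y).
    by rewrite cint_sum//; apply: eq_bigr => i _; rewrite cintZ.
  rewrite -cintB//; last exact: cmeas_sum.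
  have -> : 4 * e = 2 * (2 * e) by ring.
  apply: cint_norm_le_cst; first by apply: cmeasB => //; exact: cmeas_sum.
  by move=> y; apply: h => // z v hv; exact: hv.
have := normc_dist (cint (fun z => cint (k z))) S (cint (fun y => cint (fun z => k z y))).
by rewrite (normcB S); lra.
Qed.

Hypothesis Gh : hausdorff_space G.
Hypothesis eta_outer : outer_regular eta.
Hypothesis eta_inner : open_inner_regular eta.

Lemma compact_borel (K : set G) : compact K -> measurable (K : set (borelType G)).
Proof.
move=> cK; rewrite -[K]setCK; apply: measurableC; apply: open_borel.
by apply: closed_openC; exact: compact_closed.
Qed.

Lemma urysohn_between (K U : set G) : compact K -> open U -> K `<=` U ->
  exists phi : G -> R, [/\ ccont (fun x => (phi x)%:C%C), bmeas phi,
    forall x, 0 <= phi x <= 1, forall x, K x -> phi x = 1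
    & forall x, ~ U x -> phi x = 0].
Proof.
move=> cK oU KU; have Gn := compact_normal Gh Gc.
have sep : uniform_separator (~` U) K.
  apply: normal_uniform_separator => //; first exact: open_closedC.
    exact: compact_closed.
  by apply/seteqP; split=> x //= -[nU /KU].
pose phi : G -> R := Urysohn (~` U) K.
have cphi : ccont (fun x => (phi x)%:C%C).
  move=> x e e0; have := @Urysohn_continuous G R (~` U) K x.
  move=> /cvgrPdist_lt /(_ e e0); apply: filterS => y h.
  suff : normc ((phi y)%:C%C - (phi x)%:C%C) < e by [].
  have -> : (phi y)%:C%C - (phi x)%:C%C = (phi y - phi x)%:C%C.
    by apply/eqP; rewrite eq_complex /= subrr !eqxx.
  by rewrite normc_real distrC.
exists phi; split => //.
- by have [] := ccont_cmeas Gc cphi.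
- by move=> x; have := @Urysohn_range G R (~` U) K (phi x) (imageT _ x); rewrite /= in_itv.
- by move=> x Kx; have := @Urysohn_sub1 G R _ _ sep (phi x); apply; exists x.
- by move=> x Ux; have := @Urysohn_sub0 G R _ _ sep (phi x); apply; exists x.
Qed.

Lemma cAut_borel (s : cAut G) :
  measurable_fun [set: borelType G] (s : borelType G -> borelType G).
Proof. by apply: continuous_borel; exact: cAut_continuous. Qed.

Lemma cAut_preimage_borel (s : cAut G) (A : set (borelType G)) :
  measurable A -> measurable ((s @^-1` A) : set (borelType G)).
Proof. by move=> mA; rewrite -[X in measurable X]setTI; exact: cAut_borel. Qed.

(** By inner regularity it is enough to bound [eta K] for compact [K] in [U]. A Urysohn function
    [phi] between [K] and [U] has the same integral as [phi \o s], which is at most the measure of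
    the preimage of [U]. *)
Lemma cAut_open_le (s : cAut G) (U : set G) : open U ->
  (eta U <= eta (s @^-1` U))%E.
Proof.
move=> oU; rewrite (eta_inner oU); apply: ge_ereal_sup => _ [K [cK KU] <-].
have [phi [cphi bphi phi01 phi1 phi0]] := urysohn_between cK oU KU.
have mK := compact_borel cK.
have mU : measurable (U : set (borelType G)) by exact: open_borel.
have msU := cAut_preimage_borel s mU.
rewrite !probE// lee_fin.
have : cint ((fun x => (phi x)%:C%C) \o s) = cint (fun x => (phi x)%:C%C).
  exact: cint_aut_ccont.
rewrite /comp !cint_real => -[phis].
apply: (@le_trans _ _ (rint phi)).
  apply: rint_le => //; first exact: bmeas_indic.
  move=> x; rewrite indicE; have /andP[p0 p1] := phi01 x.
  by have [/[!inE]/phi1->|_] := boolP (x \in K).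
rewrite -phis; apply: rint_le.
- by have [] := ccont_cmeas Gc (ccont_aut s cphi).
- exact: bmeas_indic.
- move=> x; rewrite indicE; have /andP[p0 p1] := phi01 (s x).
  have [//|/negP nU] := boolP (x \in s @^-1` U).
  by rewrite phi0// => Us; apply: nU; rewrite inE.
Qed.

Lemma cAut_preimageK (s : cAut G) (A : set G) :
  (s^-1)%g @^-1` (s @^-1` A) = A.
Proof. by apply/seteqP; split=> x; rewrite /= cAut_invK. Qed.

Lemma cAut_preimage_open (s : cAut G) (U : set G) : open U -> open (s @^-1` U).
Proof. by move=> oU; apply: open_comp => // x _; exact: cAut_continuous. Qed.

(** Outer regularity reduces to open sets, where [cAut_open_le] is applied to the inverse of [s].
    Passing to the inverse once more gives equality in [cAut_measure]. *)
Lemma cAut_measure_le (s : cAut G) (A : set (borelType G)) : measurable A ->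
  (eta (s @^-1` A) <= eta A)%E.
Proof.
move=> mA; rewrite (eta_outer mA); apply: le_ereal_inf_tmp => _ [U [oU AU] <-].
have osU := cAut_preimage_open s oU.
apply: (@le_trans _ _ (eta (s @^-1` U))).
  apply: le_measure; rewrite ?inE; [exact: cAut_preimage_borel|exact: open_borel|].
  by move=> x /= /AU.
by rewrite -[in leRHS](cAut_preimageK s U); exact: cAut_open_le.
Qed.

Lemma cAut_measure (s : cAut G) (A : set (borelType G)) : measurable A ->
  eta (s @^-1` A) = eta A.
Proof.
move=> mA; apply/eqP; rewrite eq_le cAut_measure_le//=.
rewrite -[in leLHS](cAut_preimageK s A); apply: cAut_measure_le.
exact: cAut_preimage_borel.
Qed.

Lemma cint_aut (s : cAut G) F : cmeas F -> cint (F \o s) = cint F.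
Proof.
move=> mF; apply: (proj2 (cint_comp _ _ mF)); first exact: cAut_borel.
exact: cAut_measure.
Qed.

(** Inner regularity is available for open sets, so [K] is chosen inside an open [U] containing [B],
    not inside [B]; a Urysohn function between [K] and [U] is still close to [B] in mean. *)
Lemma approx_indic (B : set (borelType G)) (e : R) : measurable B -> 0 < e ->
  exists phi : G -> R, [/\ ccont (fun x => (phi x)%:C%C), bmeas phi,
    forall x, 0 <= phi x <= 1 & rint (fun x => `|\1_B x - phi x|) <= e].
Proof.
move=> mB e0; have e2 : 0 < e / 2 by rewrite divr_gt0.
have [U [oU BU] UB] : exists2 U : set G, open U /\ B `<=` U &
    rint (\1_U) < rint (\1_B) + e / 2.
  have : (ereal_inf [set eta U | U in [set U : set G | open U /\ B `<=` U]] <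
      (rint (\1_B) + e / 2)%:E)%E.
    by rewrite -(eta_outer mB) probE// lte_fin ltrDl.
  move=> /ereal_inf_lt[_ [U [oU BU] <-]] h; exists U => //.
  by rewrite -lte_fin -probE//; exact: open_borel.
have [K [cK KU] UK] : exists2 K : set G, compact K /\ K `<=` U &
    rint (\1_U) - e / 2 < rint (\1_K).
  have : ((rint (\1_U) - e / 2)%:E <
      ereal_sup [set eta K | K in [set K : set G | compact K /\ K `<=` U]])%E.
    rewrite -(eta_inner oU) probE; last exact: open_borel.
    by rewrite lte_fin ltrBlDr ltrDl.
  move=> /ereal_sup_gt[_ [K [cK KU] <-]] h; exists K => //.
  by rewrite -lte_fin -probE//; exact: compact_borel.
have [phi [cphi bphi phi01 phi1 phi0]] := urysohn_between cK oU KU.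
exists phi; split => //.
have bU : bmeas (\1_U : G -> R) by apply: bmeas_indic; exact: open_borel.
have bK : bmeas (\1_K : G -> R) by apply: bmeas_indic; exact: compact_borel.
have bB : bmeas (\1_B : G -> R) by exact: bmeas_indic.
have bUU := bmeasD bU bU; have bBK := bmeasD bB bK.
have b2 := bmeasD bUU (bmeasN bBK).
(* The error is 0 off [U], equals [1 - \1_B] on [K], and is at most 1 on the rest of [U]; the
   integral of this majorant is the excess of [U] over [B] plus that of [U] over [K]. *)
apply: (@le_trans _ _ (rint (fun x => (\1_U x + \1_U x) + - (\1_B x + \1_K x)))).
  apply: rint_le => //.
    have [m1 [k1 h1]] := bmeasD bB (bmeasN bphi).
    split; last by exists k1 => x; rewrite normr_id.
    by apply: measurableT_comp => //.
  move=> x; rewrite !indicE; have /andP[p0 p1] := phi01 x.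
  have [xU|/negP nU] := boolP (x \in U); last first.
    have Ux : ~ U x by move=> Ux; apply: nU; rewrite inE.
    rewrite phi0// memNset ?memNset; [|by move=> /KU|by move=> /BU].
    by rewrite /= subrr normr0; lra.
  have [xK|_] := boolP (x \in K).
    rewrite phi1; last by move: xK; rewrite inE.
    by case: (x \in B) => /=; rewrite ?subrr ?sub0r ?normrN ?normr1 ?normr0; lra.
  by case: (x \in B) => /=; rewrite ler_norml; apply/andP; split; lra.
by rewrite (rintD eta bUU (bmeasN bBK)) (rintN eta bBK) (rintD eta bU bU) (rintD eta bB bK); lra.
Qed.

End HaarIntegral.

(** * Positive-definite functions *)

Section PositiveDefinite.
Variables (R : realType) (G : topologicalZmodType).
Implicit Types (q F : G -> R[i]) (c : R[i]).

Definition posdef q := forall n (x : 'I_n -> G) (a : 'I_n -> R[i]),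
  0 <= \sum_(i < n) \sum_(j < n) a i * (a j)^* * q (x i - x j).

(* Convolution of [F] with [(delta_0 + c delta_y) * (delta_0 + c delta_y)^*],
   for [c] of modulus 1. *)
Definition wave c (y : G) F (z : G) : R[i] :=
  2 * F z + c * F (z + y) + c^* * F (z - y).

Lemma posdef0_ge0 q : posdef q -> 0 <= q 0.
Proof.
move=> /(_ 1%N (fun=> 0) (fun=> 1)).
by rewrite !big_ord1 subrr rmorph1 !mul1r.
Qed.

(** The form of [wave c y q] at points [x i] with coefficients [a i] is the form of [q] at twice as
    many points: the [x i] with [a i], and the [x i + y] with [c * a i]. *)
Lemma posdef_wave c y q : c * c^* = 1 -> posdef q -> posdef (wave c y q).
Proof.
move=> c1 pq n x a.
pose x' (k : 'I_(n + n)) := match fintype.split k with inl i => x i | inr i => x i + y end.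
pose a' (k : 'I_(n + n)) := match fintype.split k with inl i => a i | inr i => c * a i end.
have := pq _ x' a'; congr (0 <= _).
have xl i : x' (lshift n i) = x i by rewrite /x' (unsplitK (inl i)).
have xr i : x' (rshift n i) = x i + y by rewrite /x' (unsplitK (inr i)).
have al i : a' (lshift n i) = a i by rewrite /a' (unsplitK (inl i)).
have ar i : a' (rshift n i) = c * a i by rewrite /a' (unsplitK (inr i)).
rewrite big_split_ord /= -big_split /=; apply: eq_bigr => i _.
rewrite !big_split_ord /= -!big_split /=; apply: eq_bigr => j _.
rewrite !xl !xr !al !ar /wave rmorphM /=.
have -> : x i + y - x j = x i - x j + y by rewrite addrAC.
have -> : x i - (x j + y) = x i - x j - y by rewrite opprD addrA.
have -> : x i + y - (x j + y) = x i - x j by rewrite opprD addrACA subrr addr0.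
rewrite -[2]/(1 + 1) -{2}c1; ring.
Qed.

(** The form at the points [x] and 0 with coefficients 1 and [b]. *)
Lemma posdef_pair q x b : posdef q ->
  0 <= (1 + b * b^*) * q 0 + b^* * q x + b * q (- x).
Proof.
move=> /(_ 2%N (fun i => if i == ord0 then x else 0) (fun i => if i == ord0 then 1 else b)).
rewrite !big_ord_recl !big_ord0 /= !subrr subr0 sub0r rmorph1; congr (0 <= _); ring.
Qed.

Lemma posdef_norm_le q x : posdef q -> normc (q x) <= cRe (q 0).
Proof.
move=> pq; have := posdef0_ge0 pq; rewrite lecE => /andP[/eqP im0 re0].
have q0E : q 0 = (cRe (q 0))%:C%C by rewrite [LHS]complexE im0 mulr0 addr0.
have H b := posdef_pair x b pq.
move: H; rewrite q0E; set k := cRe (q 0).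
case: (q x) => p r; case: (q (- x)) => p' r' H.
(* The values 1 and ['i] of [b] show that [q (- x)] is the conjugate of [q x]. *)
have := H 1; rewrite lecE => /andP[/eqP /= h1 _].
have := H (Complex 0 1); rewrite lecE => /andP[/eqP /= h2 _].
have {}h1 : r' = - r by lra.
have {}h2 : p' = p by lra.
subst r' p'; set u := Num.sqrt (p ^+ 2 + r ^+ 2).
have [u0|u0] := eqVneq u 0; first by rewrite u0.
have u2 : u ^+ 2 = p ^+ 2 + r ^+ 2 by rewrite sqr_sqrtr// addr_ge0 ?sqr_ge0.
(* For [b] equal to [- q x / |q x|] the two cross terms add up to [- 2 * |q x|]. *)
have := H (Complex (- p / u) (- r / u)); rewrite lecE => /andP[_ /=].
set e := (X in 0 <= X -> _); have -> : e = 2 * (k - u); last by lra.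
have uu : (p / u) ^+ 2 + (r / u) ^+ 2 = 1.
  by rewrite !expr_div_n -mulrDl -u2 divff// expf_neq0.
have pr : p * (p / u) + r * (r / u) = u.
  by rewrite !mulrA -mulrDl -!expr2 -u2 expr2 mulfK.
rewrite /e; transitivity ((1 + ((p / u) ^+ 2 + (r / u) ^+ 2)) * k
  - 2 * (p * (p / u) + r * (r / u))); first by ring.
by rewrite uu pr; ring.
Qed.

End PositiveDefinite.

(** * Limits of complex functions along an ultrafilter *)

Section UltraLimit.
Variables (R : realType) (T : Type) (U : set_system T).
Context {UU : UltraFilter U}.
Implicit Types (v w : T -> R[i]) (l : R[i]).

Definition tends v l := forall e : R, 0 < e -> \forall t \near U, normc (v t - l) < e.

Lemma tendsD v w l m : tends v l -> tends w m -> tends (fun t => v t + w t) (l + m).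
Proof.
move=> vl wm e e0; have e2 : 0 < e / 2 by rewrite divr_gt0.
apply: filterS2 (vl _ e2) (wm _ e2) => t h1 h2.
rewrite opprD addrACA (le_lt_trans (normcD_le _ _))//.
by rewrite [ltRHS]splitr ltrD.
Qed.

Lemma tendsM v w l m : tends v l -> tends w m -> tends (fun t => v t * w t) (l * m).
Proof.
move=> vl wm e e0; set K := 1 + normc l + normc m.
have K0 : 0 < K by rewrite /K -addrA ltr_pwDl// addr_ge0 ?normc_ge0.
(* The bound 1 controls the product of the two errors, and [e / K] makes the three terms of the
   expansion add up to [e]. *)
have d0 : 0 < Num.min 1 (e / K) by rewrite lt_min ltr01 divr_gt0.
apply: filterS2 (vl _ d0) (wm _ d0) => t.
rewrite !lt_min => /andP[h1 h2] /andP[_ h3].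
rewrite (_ : _ - _ = (v t - l) * (w t - m) + l * (w t - m) + m * (v t - l)); last by ring.
rewrite (le_lt_trans (normcD_le _ _))// (le_lt_trans (lerD (normcD_le _ _) (lexx _)))//.
rewrite !normcM; have -> : e = 1 * (e / K) + normc l * (e / K) + normc m * (e / K).
  by rewrite -!mulrDl mulrCA divff ?mulr1// gt_eqF.
rewrite ltr_leD//; last by rewrite ler_wpM2l ?normc_ge0// ltW.
rewrite ltr_leD//; last by rewrite ler_wpM2l ?normc_ge0// ltW.
by rewrite ltr_pM ?normc_ge0.
Qed.

Lemma tends_cst l : tends (fun=> l) l.
Proof. by move=> e e0; near=> t; rewrite subrr normc0.
Unshelve. all: by end_near. Qed.

Lemma tends_near v w l : (\forall t \near U, v t = w t) -> tends v l -> tends w l.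
Proof. by move=> vw vl e e0; apply: filterS2 vw (vl e e0) => t ->. Qed.

Lemma tends_unique v l m : tends v l -> tends v m -> l = m.
Proof.
move=> vl vm; apply/eqP; rewrite -subr_eq0; apply/eqP.
apply: eq0_normc; apply/eqP; rewrite eq_le normc_ge0 andbT leNgt; apply/negP => e0.
have e2 : 0 < normc (l - m) / 2 by rewrite divr_gt0.
have [t []] := filter_ex (filterI (vl _ e2) (vm _ e2)).
move=> h1 h2; have := normc_dist l (v t) m; rewrite (normcB l (v t)).
by rewrite leNgt [normc (l - m)]splitr ltrD.
Qed.

Lemma tends_Re_le v w l m : tends v l -> tends w m ->
  (\forall t \near U, cRe (v t) <= cRe (w t)) -> cRe l <= cRe m.
Proof.
move=> vl wm vw; rewrite leNgt; apply/negP => ml.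
have e0 : 0 < (cRe l - cRe m) / 2 by rewrite divr_gt0// subr_gt0.
have [t [tvw [h1 h2]]] := filter_ex (filterI vw (filterI (vl _ e0) (wm _ e0))).
have := le_lt_trans (normRe_le _) h1; have := le_lt_trans (normRe_le _) h2.
have reB (z z' : R[i]) : cRe (z - z') = cRe z - cRe z' by case: z; case: z'.
rewrite !reB !ltr_norml => /andP[_ h4] /andP[h3 _].
move: tvw e0 h3 h4; move: (cRe (v t)) (cRe (w t)) (cRe l) (cRe m) => a b c d; lra.
Qed.

(** The segment is compact, so the image filter has a cluster point there, and an ultrafilter
    converges to each of its cluster points. *)
Lemma ultra_bounded_real (f : T -> R) (k : R) : (\forall t \near U, `|f t| <= k) ->
  exists l : R, forall e, 0 < e -> \forall t \near U, `|f t - l| < e.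
Proof.
move=> fk; have FA : (f @ U) [set` `[-k, k]].
  by apply: filterS fk => t /=; rewrite in_itv /= -ler_norml.
have [l [_ cl]] := @segment_compact R (-k) k (f @ U) _ FA.
exists l => e e0; have [//|h] := in_ultra_setVsetC [set t | `|f t - l| < e] UU.
have h' : (f @ U) (~` [set y | `|y - l| < e]) by exact: h.
have nl : nbhs l [set y | `|y - l| < e].
  by apply: filterS (nbhsx_ballx l e e0) => y; rewrite /ball /= distrC.
by have [y [/= h1 h2]] := cl _ _ h' nl.
Qed.

Lemma ultra_bounded v (k : R) : (\forall t \near U, normc (v t) <= k) ->
  exists l, tends v l.
Proof.
move=> vk.
have [|a ha] := @ultra_bounded_real (cRe \o v) k.
  by apply: filterS vk => t /(le_trans (normRe_le _)).
have [|b hb] := @ultra_bounded_real (cIm \o v) k.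
  by apply: filterS vk => t /(le_trans (normIm_le _)).
exists (Complex a b) => e e0; have e2 : 0 < e / 2 by rewrite divr_gt0.
apply: filterS2 (ha _ e2) (hb _ e2) => t /=; case: (v t) => x y h1 h2.
by rewrite (le_lt_trans (normc_le _))//=; lra.
Qed.

End UltraLimit.

(** * Correlation of continuous functions *)

Section Correlation.
Variables (R : realType) (G : topologicalZmodType).
Hypothesis Gc : compact [set: G].
Variable eta : probability (borelType G) R.
Hypothesis eta_inv : translation_invariant eta.
Implicit Types (q h F : G -> R[i]).
Local Notation cint := (cint eta).

(** In Fourier coefficients this multiplies those of [q] by the conjugates of those of [h]. *)
Definition corr h q (z : G) : R[i] := cint (fun y => (h y)^* * q (z + y)).

Lemma ccont_shiftl z F : ccont F -> ccont (fun y => F (z + y)).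
Proof.
move=> cF; rewrite (_ : (fun y => _) = fun y => F (y + z)); first exact: ccont_shift.
by apply/funext => y; rewrite addrC.
Qed.

Lemma ccont_wave c y F : ccont F -> ccont (wave c y F).
Proof.
move=> cF; apply: ccontD; first apply: ccontD.
- by apply: ccontM => //; exact: ccont_cst.
- by apply: ccontM; [exact: ccont_cst|exact: ccont_shift].
- by apply: ccontM; [exact: ccont_cst|exact: ccont_shift].
Qed.

Lemma corr_integrand h q z : ccont h -> ccont q ->
  ccont (fun y => (h y)^* * q (z + y)).
Proof. by move=> ch cq; apply: ccontM; [exact: ccontJ|exact: ccont_shiftl]. Qed.

Lemma corr_wave h q c y : ccont h -> ccont q ->
  corr h (wave c y q) = wave c y (corr h q).
Proof.
move=> ch cq; apply/funext => z; rewrite /wave /corr.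
have m z' : cmeas (fun w => (h w)^* * q (z' + w)).
  by apply: ccont_cmeas => //; exact: corr_integrand.
rewrite -!cintZ// -!cintD//; do ?[exact: cmeasZ|apply: cmeasD; exact: cmeasZ].
congr cint; apply/funext => w.
rewrite (addrAC z w y) (addrAC z w (- y)); ring.
Qed.

Lemma corrZ h q c : ccont h -> ccont q ->
  corr h (fun x => c * q x) = fun z => c * corr h q z.
Proof.
move=> ch cq; apply/funext => z; rewrite /corr -cintZ.
  by congr cint; apply/funext => w; ring.
by apply: ccont_cmeas => //; exact: corr_integrand.
Qed.

Lemma corr_norm_le h q (kh k : R) : ccont h -> ccont q ->
  (forall x, normc (h x) <= kh) -> (forall x, normc (q x) <= k) ->
  forall z, normc (corr h q z) <= 2 * (kh * k).
Proof.
move=> ch cq hk qk z; apply: cint_norm_le_cst.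
  by apply: ccont_cmeas => //; exact: corr_integrand.
by move=> x; rewrite normcM normcJ_eq ler_pM// normc_ge0.
Qed.

(** Invariance of [eta] moves the shift from [q] to [h]. The modulus of continuity therefore depends
    on [q] only through its bound, which makes the functions [corr h q] equicontinuous. *)
Lemma corr_unif h q (k e : R) v : ccont h -> ccont q ->
  (forall x, normc (q x) <= k) -> (forall x, normc (h (x + v) - h x) <= e) ->
  forall z, normc (corr h q (z + v) - corr h q z) <= 2 * (e * k).
Proof.
move=> ch cq qk hv z.
have m z' : cmeas (fun y => (h y)^* * q (z' + y)).
  by apply: ccont_cmeas => //; exact: corr_integrand.
rewrite /corr -(cint_shift eta_inv v (m z)) -cintB//; last first.
  exact: (cmeas_shift eta_inv v (m z)).
apply: cint_norm_le_cst.
  by apply: cmeasB => //; exact: (cmeas_shift eta_inv v (m z)).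
move=> y; rewrite (_ : z + (y + v) = z + v + y); last by rewrite [y + v]addrC addrA.
rewrite -mulrBl normcM ler_pM ?normc_ge0//.
by rewrite -rmorphB normcJ_eq normcB.
Qed.

Lemma corr_ccont h q : ccont h -> ccont q -> ccont (corr h q).
Proof.
move=> ch cq x e e0; have [k qk] := ccont_bounded Gc cq.
have k0 : 0 <= k by rewrite (le_trans (normc_ge0 (q 0))).
have e1 : 0 < e / (4 * (k + 1)) by rewrite divr_gt0// mulr_gt0//; lra.
apply: filterS (near_sub x (ccont_unif Gc ch e1)) => y hv.
rewrite (_ : y = x + (y - x)); last by rewrite addrC subrK.
apply: le_lt_trans (corr_unif ch cq qk _ x) _ => [z|]; first exact/ltW/hv.
rewrite -[ltRHS]mulr1; rewrite (_ : 2 * _ = e * (k / (2 * (k + 1)))).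
  by rewrite ltr_pM2l// ltr_pdivrMr; lra.
by field; lra.
Qed.

End Correlation.

(** * Uniform limits along an ultrafilter *)

Section UniformLimit.
Variables (R : realType) (G : topologicalZmodType).
Hypothesis Gc : compact [set: G].
Variable eta : probability (borelType G) R.
Variables (T : Type) (U : set_system T).
Context {UU : UltraFilter U}.
Implicit Types (F : G -> R[i]).
Local Notation cint := (cint eta).

Definition utends (a : T -> G -> R[i]) F :=
  forall e : R, 0 < e -> \forall t \near U, forall x, normc (a t x - F x) < e.

Lemma utends_wave a F c y : utends a F ->
  utends (fun t => wave c y (a t)) (wave c y F).
Proof.
move=> aF e e0; set K := 2 + normc c + normc c.
have K0 : 0 < K by rewrite /K -addrA ltr_pwDl// addr_ge0 ?normc_ge0.
have d0 : 0 < e / (K + 1) by rewrite divr_gt0// ltr_wpDr.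
apply: filterS (aF _ d0) => t h x.
rewrite (_ : _ - _ = 2 * (a t x - F x) + c * (a t (x + y) - F (x + y)) +
  c^* * (a t (x - y) - F (x - y))); last by rewrite /wave; ring.
apply: le_lt_trans (normcD_le _ _) _.
apply: le_lt_trans (lerD (normcD_le _ _) (lexx _)) _.
have n2 : normc (2 : R[i]) = 2.
  by have := normc_real (2 : R); rewrite ger0_norm// => <-; rewrite rmorph_nat.
rewrite !normcM normcJ_eq n2.
apply: (@le_lt_trans _ _ (K * (e / (K + 1)))).
  by rewrite /K !mulrDl !lerD// ler_wpM2l ?normc_ge0// ltW.
by rewrite mulrCA gtr_pMr// ltr_pdivrMr ?mul1r ?ltrDl// ltr_wpDr.
Qed.

Lemma utends_cint a F : (\forall t \near U, cmeas (a t)) -> cmeas F ->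
  utends a F -> tends U (fun t => cint (a t)) (cint F).
Proof.
move=> ma mF aF e e0; have e4 : 0 < e / 4 by rewrite divr_gt0.
apply: filterS2 ma (aF _ e4) => t mat h; rewrite -cintB//.
apply: (@le_lt_trans _ _ (2 * (e / 4))); last by lra.
apply: cint_norm_le_cst; first exact: cmeasB.
by move=> x; exact/ltW/h.
Qed.

Lemma utendsM a b F H (k : R) : (forall x, normc (F x) <= k) ->
  (forall x, normc (H x) <= k) -> utends a F -> utends b H ->
  utends (fun t x => a t x * b t x) (fun x => F x * H x).
Proof.
move=> Fk Hk aF bH e e0; set K := 1 + k + k.
have k0 : 0 <= k by rewrite (le_trans (normc_ge0 (F 0))).
have K0 : 0 < K by rewrite /K -addrA ltr_pwDl// addr_ge0.
have d0 : 0 < Num.min 1 (e / K) by rewrite lt_min ltr01 divr_gt0.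
apply: filterS2 (aF _ d0) (bH _ d0) => t h1' h2' x.
have := h1' x; have := h2' x.
rewrite !lt_min => /andP[h1 h2] /andP[_ h3].
rewrite (_ : _ - _ = (a t x - F x) * (b t x - H x) + F x * (b t x - H x) +
  H x * (a t x - F x)); last by ring.
rewrite (le_lt_trans (normcD_le _ _))// (le_lt_trans (lerD (normcD_le _ _) (lexx _)))//.
rewrite !normcM; have -> : e = 1 * (e / K) + k * (e / K) + k * (e / K).
  by rewrite -!mulrDl mulrCA divff ?mulr1// gt_eqF.
rewrite ltr_leD//; last by rewrite ler_pM ?normc_ge0// ltW.
rewrite ltr_leD//; last by rewrite ler_pM ?normc_ge0// ltW.
by rewrite mulrC ltr_pM ?normc_ge0.
Qed.

Lemma utendsJ a F : utends a F -> utends (fun t x => (a t x)^*) (fun x => (F x)^*).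
Proof.
by move=> aF e e0; apply: filterS (aF e e0) => t h x; rewrite -rmorphB normcJ_eq.
Qed.

Lemma utends_cst F : utends (fun=> F) F.
Proof. by move=> e e0; near=> t => x; rewrite subrr normc0.
Unshelve. all: by end_near. Qed.

Section Equicontinuous.
Variables (a : T -> G -> R[i]) (F : G -> R[i]).
Hypothesis equi : forall e : R, 0 < e -> \forall v \near (0 : G) & t \near U,
  forall x, normc (a t (x + v) - a t x) < e.
Hypothesis ptws : forall x, tends U (a^~ x) (F x).

(** A single [t] at which [a t] is close to [F] at both [x + v] and [x] transfers the common modulus
    of continuity to [F]. *)
Let limit_unif (e : R) : 0 < e ->
  \forall v \near (0 : G), forall x, normc (F (x + v) - F x) < e.
Proof.
move=> e0; have e3 : 0 < e / 3 by rewrite divr_gt0.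
have [[A B] /= [A0 UB] AB] := equi e3; apply: filterS A0 => v Av x.
have [t [Bt [h1 h2]]] := filter_ex (filterI UB (filterI (ptws (x + v) e3) (ptws x e3))).
have := AB (v, t) (conj Av Bt) x => /= h3.
have := normc_dist (F (x + v)) (a t (x + v)) (F x).
have := normc_dist (a t (x + v)) (a t x) (F x).
by move: h1 h2 h3; rewrite (normcB (F (x + v)) (a t (x + v))); lra.
Qed.

Lemma equicontinuous_ccont : ccont F.
Proof.
move=> x e e0; apply: filterS (near_sub x (limit_unif e0)) => y /(_ x).
by rewrite [x + _]addrC subrK.
Qed.

(** The Arzela-Ascoli argument: near [x], both [a t] and [F] vary little, so closeness at [x]
    spreads to a neighbourhood, and compactness makes it uniform. *)
Lemma equicontinuous_utends : utends a F.
Proof.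
move=> e e0; have e3 : 0 < e / 3 by rewrite divr_gt0.
have [[A B] /= [A0 UB] AB] := equi e3.
have /compact_near_coveringP cov := Gc.
have h x : [set: G] x -> \forall y \near x & t \near U, normc (a t y - F y) < e.
  move=> _; exists ([set y | A (y - x)] `&` [set y | forall z, normc (F (z + (y - x)) - F z) < e / 3],
    B `&` [set t | normc (a t x - F x) < e / 3]).
    split; first exact: filterI (near_sub x A0) (near_sub x (limit_unif e3)).
    exact: filterI UB (ptws x e3).
  move=> [y t] /= [[Ay Fy] [Bt h1]].
  have := AB (y - x, t) (conj Ay Bt) x => /=.
  have := Fy x; rewrite [x + _]addrC subrK => h2 h3.
  have := normc_dist (a t y) (a t x) (F y).
  have := normc_dist (a t x) (F x) (F y).
  by move: h1 h2 h3; rewrite (normcB (F y) (F x)); lra.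
have near_all : U (fun t => [set: G] `<=` fun y => normc (a t y - F y) < e)
  := cov _ _ (fun t y => normc (a t y - F y) < e)
  (@filter_filter _ _ (@ultra_proper _ _ UU)) h.
by apply: filterS near_all => t ht x; exact: ht.
Qed.

End Equicontinuous.

End UniformLimit.

(** * Existence of characters *)

Section CharacterExistence.
Variables (R : realType) (G : topologicalZmodType).
Hypothesis Gc : compact [set: G].
Variable eta : probability (borelType G) R.
Hypothesis eta_inv : translation_invariant eta.
Implicit Types (q F : G -> R[i]) (c : R[i]).
Local Notation cint := (cint eta).
Local Notation corr := (corr eta).

Definition sqnorm F : R := cRe (cint (fun x => F x * (F x)^*)).

Lemma ccont_sqr F : ccont F -> ccont (fun x => F x * (F x)^*).
Proof. by move=> cF; apply: ccontM => //; exact: ccontJ. Qed.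

Lemma sqnormE F : cint (fun x => F x * (F x)^*) = (sqnorm F)%:C%C.
Proof.
rewrite /sqnorm (_ : (fun x => _) = fun x => ((normc (F x)) ^+ 2)%:C%C).
  by rewrite cint_real.
by apply/funext => x; rewrite mulJ_normc.
Qed.

Lemma sqnorm_ge0 F : ccont F -> 0 <= sqnorm F.
Proof.
move=> cF; rewrite -lecR -sqnormE; apply: cint_ge0.
  by apply: ccont_cmeas => //; exact: ccont_sqr.
by move=> x; rewrite mulJ_normc lecR sqr_ge0.
Qed.

Lemma sqnorm_eq0 F : ccont F -> sqnorm F <= 0 -> forall x, F x = 0.
Proof.
move=> cF n0; apply: (cint_sqr_eq0 Gc eta_inv cF).
rewrite sqnormE; suff -> : sqnorm F = 0 by [].
by apply/eqP; rewrite eq_le n0 sqnorm_ge0.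
Qed.

Lemma sqnorm_comb F1 F2 (a b : R) : ccont F1 -> ccont F2 ->
  sqnorm (fun x => a%:C%C * F1 x + b%:C%C * F2 x) =
  a ^+ 2 * sqnorm F1 + a * b * (cRe (cint (fun x => F1 x * (F2 x)^*)) +
    cRe (cint (fun x => F2 x * (F1 x)^*))) + b ^+ 2 * sqnorm F2.
Proof.
move=> c1 c2; apply: complexI; rewrite -sqnormE.
have m (F F' : G -> R[i]) : ccont F -> ccont F' -> cmeas (fun x => F x * (F' x)^*).
  by move=> cF cF'; apply: ccont_cmeas => //; apply: ccontM => //; exact: ccontJ.
have aJ (k : R) : (k%:C%C)^* = k%:C%C by rewrite conjE conjc_real.
rewrite (_ : (fun x => _) = fun x => (a ^+ 2)%:C%C * (F1 x * (F1 x)^*) +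
  ((a * b)%:C%C * (F1 x * (F2 x)^* + F2 x * (F1 x)^*) +
   (b ^+ 2)%:C%C * (F2 x * (F2 x)^*))); last first.
  apply/funext => x; by rewrite rmorphD !rmorphM /= !aJ ?rmorphXn /=; ring.
have m12 : cmeas (fun x => F1 x * (F2 x)^* + F2 x * (F1 x)^*) by apply: cmeasD; exact: m.
rewrite cintD; [|exact/cmeasZ/m|by apply: cmeasD; [exact: cmeasZ|exact/cmeasZ/m]].
rewrite cintD; [|exact: cmeasZ|exact/cmeasZ/m].
rewrite !cintZ; do ?[exact: m|by []]. rewrite cintD; do ?[exact: m].
rewrite !sqnormE !rmorphD !rmorphM -addrA; congr (_ + (_ * _ + _)).
(* The two cross integrals are conjugate, so their sum is real. *)
have -> : cint (fun x => F2 x * (F1 x)^*) = (cint (fun x => F1 x * (F2 x)^*))^*.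
  rewrite -cintJ; last exact: m.
  by congr cint; apply/funext => x; rewrite rmorphM /= conjCK mulrC.
case: (cint _) => x y; rewrite conjE /=.
by apply/eqP; rewrite eq_complex /= ?subrr ?addr0 !eqxx.
Qed.

Lemma sqnormZ F (a : R) : ccont F -> sqnorm (fun x => a%:C%C * F x) = a ^+ 2 * sqnorm F.
Proof.
move=> cF; have := sqnorm_comb a 0 cF cF; rewrite expr0n /= !(mulr0, mul0r, addr0) => <-.
by congr sqnorm; apply/funext => x; rewrite mul0r addr0.
Qed.

Lemma posdefZ q (k : R) : 0 <= k -> posdef q -> posdef (fun x => k%:C%C * q x).
Proof.
move=> k0 pq n x a.
have := mulr_ge0 (_ : 0 <= k%:C%C) (pq n x a); rewrite lecR => /(_ k0); congr (0 <= _).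
rewrite mulr_sumr; apply: eq_bigr => i _; rewrite mulr_sumr; apply: eq_bigr => j _; ring.
Qed.

Lemma tends_ge0 (T : Type) (U : set_system T) (UU : UltraFilter U) (v : T -> R[i]) l :
  tends U v l -> (\forall t \near U, 0 <= v t) -> 0 <= l.
Proof.
move=> vl v0; rewrite lecE; apply/andP; split.
  rewrite -normr_eq0 eq_le normr_ge0 andbT leNgt; apply/negP => e0.
  have [t [/= vt0]] := filter_ex (filterI v0 (vl _ e0)).
  rewrite normcB => /(le_lt_trans (normIm_le _)).
  move: vt0; rewrite lecE => /andP[/eqP /= + _]; case: (v t) (l) => a b [x y] /= ->.
  by rewrite oppr0 addr0 ltxx.
have c0 : tends U (fun=> 0 : R[i]) 0 by exact: tends_cst.
apply: (tends_Re_le c0 vl).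
by apply: filterS v0 => t; rewrite lecE => /andP[].
Qed.

(** * The extremal problem for a positive-definite function *)

Section Maximizer.
Variable h : G -> R[i].
Hypothesis ch : ccont h.
Hypothesis ph : posdef h.
Hypothesis h0 : h 0 != 0.

Let Q := [set q : G -> R[i] | [/\ posdef q, ccont q & q 0 = 1]].

Let Q_le1 q x : Q q -> normc (q x) <= 1.
Proof. by move=> [pq _ q1]; have := posdef_norm_le x pq; rewrite q1. Qed.

Let posdef0_real q : posdef q -> q 0 = (cRe (q 0))%:C%C.
Proof.
move=> /posdef0_ge0; case: (q 0) => a b; rewrite lecE /= => /andP[/eqP -> _].
by apply/eqP; rewrite eq_complex /= !eqxx.
Qed.

Let Q_normalize q : posdef q -> ccont q -> 0 < cRe (q 0) ->
  Q (fun x => ((cRe (q 0))^-1)%:C%C * q x).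
Proof.
move=> pq cq k0; split; first by apply: posdefZ => //; rewrite invr_ge0 ltW.
  by apply: ccontM => //; exact: ccont_cst.
by rewrite [in RHS](_ : 1 = 1%:C%C)// {2}posdef0_real// -rmorphM mulVf// gt_eqF.
Qed.

Let h0_gt0 : 0 < cRe (h 0).
Proof.
have := posdef0_ge0 ph; rewrite lecE => /andP[_ /=].
rewrite le_eqVlt => /orP[/eqP k0|//]; move: h0.
by rewrite posdef0_real// -k0 eqxx.
Qed.

Let corr_bounded : exists K : R, forall q z, Q q -> normc (corr h q z) <= K.
Proof.
have [kh hk] := ccont_bounded Gc ch; exists (2 * (kh * 1)) => q z Qq.
have [_ cq _] := Qq.
by apply: corr_norm_le => // x; exact: Q_le1.
Qed.

Let S := [set sqnorm (corr h q) | q in Q].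

Let S_sup : has_sup S.
Proof.
split; first by eexists; exists (fun x => ((cRe (h 0))^-1)%:C%C * h x) => //; exact: Q_normalize.
have [K hK] := corr_bounded; exists (2 * (K * K)) => _ [q Qq <-].
have [_ cq _] := Qq.
rewrite (le_trans (ler_norm _))// (le_trans (normRe_le _))//.
apply: cint_norm_le_cst; first by apply: ccont_cmeas => //; exact/ccont_sqr/corr_ccont.
by move=> x; rewrite normcM normcJ_eq ler_pM ?normc_ge0// hK.
Qed.

Let m := sup S.

(** Homogeneity removes the normalisation [q 0 = 1]; if [q 0] is 0, then [q] vanishes identically by
    [posdef_norm_le]. *)
Let sqnorm_corr_le q : posdef q -> ccont q ->
  sqnorm (corr h q) <= m * (cRe (q 0)) ^+ 2.
Proof.
move=> pq cq; have := posdef0_ge0 pq; rewrite lecE => /andP[_ /=].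
have ccq : ccont (corr h q) by exact: corr_ccont.
rewrite le_eqVlt => /orP[/eqP k0|k0].
  have qE : q = fun x => 0%:C%C * q x.
    apply/funext => x; rewrite mul0r; apply: eq0_normc.
    by apply/eqP; rewrite eq_le normc_ge0 andbT k0 posdef_norm_le.
  rewrite -k0 expr0n mulr0 {1}qE corrZ// sqnormZ// expr0n mul0r//.
have Qq := Q_normalize pq cq k0.
have : sqnorm (corr h (fun x => ((cRe (q 0))^-1)%:C%C * q x)) <= m.
  by apply: ub_le_sup; [exact: (proj2 S_sup)|exists (fun x => ((cRe (q 0))^-1)%:C%C * q x)].
rewrite corrZ// sqnormZ// exprVn mulrC ler_pdivrMr ?exprn_gt0//.
Qed.

(** Otherwise [corr h h] would vanish, but its value at 0 is the integral of [|h|^2], which is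
    nonzero because [h] is continuous and [h 0] is not 0. *)
Let m_gt0 : 0 < m.
Proof.
have := sqnorm_corr_le ph ch; rewrite ltNge => le1; apply/negP => m0.
have := le_trans le1 (mulr_le0_ge0 m0 (sqr_ge0 _)).
move=> /(sqnorm_eq0 (corr_ccont Gc eta_inv ch ch)) /(_ 0); rewrite /corr => hh.
have := cint_sqr_eq0 Gc eta_inv ch _ 0; rewrite -[X in _ = X]hh.
suff E : (fun x => h x * (h x)^*) = (fun y => (h y)^* * h (0 + y)).
  by rewrite E => /(_ erefl) /eqP; rewrite (negbTE h0).
by apply/funext => x; rewrite add0r mulrC.
Qed.

(** The filter generated by the sets of almost maximizers; along any ultrafilter refining it,
    [sqnorm (corr h q)] tends to [m]. *)
Let near_max := [set A : set (G -> R[i]) | exists2 e : R, 0 < e &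
  forall q, Q q -> m - e < sqnorm (corr h q) -> A q].

Let near_max_proper : ProperFilter near_max.
Proof.
split.
  move=> [e e0 /= H]; have [_ [q Qq <-] mq] := sup_adherent e0 S_sup.
  exact: H q Qq mq.
split.
- by exists 1.
- move=> A B [e1 e10 H1] [e2 e20 H2]; exists (Num.min e1 e2).
    by rewrite lt_min e10.
  move=> q Qq hq; split; [apply: H1|apply: H2] => //; apply: le_lt_trans hq;
    by rewrite lerB// ge_min lexx ?orbT.
- by move=> A B AB [e e0 H]; exists e => // q Qq hq; exact/AB/H.
Qed.

Section Limit.
Variable U : set_system (G -> R[i]).
Hypothesis UU : UltraFilter U.
Hypothesis sub_near_max : near_max `<=` U.

Let U_Q : U Q.
Proof. by apply: sub_near_max; exists 1. Qed.

Let U_max (e : R) : 0 < e -> U [set q | m - e < sqnorm (corr h q)].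
Proof. by move=> e0; apply: sub_near_max; exists e. Qed.

Let ev_limit x : exists l, tends U (fun q => q x) l.
Proof. by apply: (@ultra_bounded _ _ _ UU _ 1); apply: filterS U_Q => q; exact: Q_le1. Qed.

Let corr_limit x : exists l, tends U (fun q => corr h q x) l.
Proof.
have [K hK] := corr_bounded.
by apply: (@ultra_bounded _ _ _ UU _ K); apply: filterS U_Q => q; exact: hK.
Qed.

(** [p] is so far only a pointwise limit; its continuity follows later from that of [r], which is a
    uniform limit by equicontinuity. *)
Let p x := projT1 (cid (ev_limit x)).
Let r x := projT1 (cid (corr_limit x)).

Let p_lim x : tends U (fun q => q x) (p x).
Proof. exact: projT2 (cid (ev_limit x)). Qed.

Let r_lim x : tends U (fun q => corr h q x) (r x).
Proof. exact: projT2 (cid (corr_limit x)). Qed.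

Let corr_equi (e : R) : 0 < e -> \forall v \near (0 : G) & q \near U,
  forall x, normc (corr h q (x + v) - corr h q x) < e.
Proof.
move=> e0; have e4 : 0 < e / 4 by rewrite divr_gt0.
have hu := ccont_unif Gc ch e4.
exists ([set v | forall x, normc (h (x + v) - h x) < e / 4], Q) => //=.
move=> [v q] /= [hv Qq] x; have [_ cq _] := Qq.
apply: le_lt_trans (corr_unif Gc eta_inv ch cq (fun y => Q_le1 y Qq) (fun y => ltW (hv y)) x) _.
lra.
Qed.

Let cr : ccont r.
Proof. exact: (equicontinuous_ccont corr_equi r_lim). Qed.

Let r_ulim : utends U (corr h) r.
Proof. exact: (equicontinuous_utends Gc corr_equi r_lim). Qed.

Let sqr_lim (a : (G -> R[i]) -> G -> R[i]) F : ccont F -> utends U a F ->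
  (\forall q \near U, ccont (a q)) ->
  tends U (fun q => cint (fun x => a q x * (a q x)^*)) (cint (fun x => F x * (F x)^*)).
Proof.
move=> cF aF ca; have [k Fk] := ccont_bounded Gc cF.
apply: utends_cint.
- by apply: filterS ca => q cq; apply: ccont_cmeas => //; exact: ccont_sqr.
- by apply: ccont_cmeas => //; exact: ccont_sqr.
- apply: (@utendsM _ _ _ _ UU _ _ _ _ k) => //.
    by move=> x; rewrite normcJ_eq.
  exact: utendsJ.
Qed.

Let near_corr : \forall q \near U, ccont (corr h q).
Proof. by apply: filterS U_Q => q [_ cq _]; exact: corr_ccont. Qed.

Let sqnorm_r : sqnorm r = m.
Proof.
have rl := sqr_lim cr r_ulim near_corr.
apply/eqP; rewrite eq_le; apply/andP; split.
  have cm : tends U (fun=> m%:C%C : R[i]) m%:C%C by exact: tends_cst.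
  apply: (tends_Re_le rl cm); apply: filterS U_Q => q [pq cq q1].
  by have := sqnorm_corr_le pq cq; rewrite q1 expr1n mulr1.
apply/ler_addgt0Pr => e e0; rewrite -lerBlDr.
have cm : tends U (fun=> (m - e)%:C%C : R[i]) (m - e)%:C%C by exact: tends_cst.
by apply: (tends_Re_le cm rl); apply: filterS (U_max e0) => q; exact: ltW.
Qed.

Let p0 : p 0 = 1.
Proof.
apply: (tends_unique (p_lim 0)).
have : tends U (fun=> 1 : R[i]) 1 by exact: tends_cst.
by apply: tends_near; apply: filterS U_Q => q [].
Qed.

Let wave_p c y : tends U (fun q => wave c y q 0) (wave c y p 0).
Proof.
apply: tendsD; first apply: tendsD; apply: tendsM; (exact: tends_cst || exact: p_lim).
Qed.

Let wave_p_ge0 c y : c * c^* = 1 -> 0 <= wave c y p 0.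
Proof.
move=> c1; apply: (tends_ge0 UU (wave_p c y)).
by apply: filterS U_Q => q [pq _ _]; apply: posdef0_ge0; exact: posdef_wave.
Qed.

Let wave_pE c y : c * c^* = 1 -> wave c y p 0 = (cRe (wave c y p 0))%:C%C.
Proof.
move=> /(wave_p_ge0 y); case: (wave _ _ _ _) => a b; rewrite lecE /= => /andP[/eqP -> _].
by apply/eqP; rewrite eq_complex /= !eqxx.
Qed.

(** For [q] in [Q] this is maximality of [m] applied to the positive-definite function [wave c y q],
    as [corr h] commutes with [wave]; both sides pass to the limit. *)
Let sqnorm_wave_le c y : c * c^* = 1 ->
  sqnorm (wave c y r) <= m * (cRe (wave c y p 0)) ^+ 2.
Proof.
move=> c1.
have rl : tends U (fun q => cint (fun x => wave c y (corr h q) x * (wave c y (corr h q) x)^*))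
    (cint (fun x => wave c y r x * (wave c y r x)^*)).
  apply: (sqr_lim (a := fun q => wave c y (corr h q))).
  - exact: ccont_wave.
  - exact: utends_wave.
  - by apply: filterS near_corr => q; exact: ccont_wave.
have wl : tends U (fun q => m%:C%C * (wave c y q 0 * wave c y q 0))
    (m%:C%C * (wave c y p 0 * wave c y p 0)).
  by apply: tendsM; [exact: tends_cst|apply: tendsM; exact: wave_p].
have := tends_Re_le rl wl.
have ReE (z : R[i]) : z = (cRe z)%:C%C -> cRe (m%:C%C * (z * z)) = m * (cRe z) ^+ 2.
  by move=> ->; rewrite -!rmorphM /= expr2.
rewrite (ReE _ (wave_pE y c1)); apply; apply: filterS U_Q => q [pq cq _].
have pw := posdef_wave y c1 pq.
rewrite (ReE _ (posdef0_real pw)) -corr_wave//.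
by apply: sqnorm_corr_le => //; exact: ccont_wave.
Qed.

(* Strict convexity of the squared norm forces the two halves of the
   decomposition 4 r = wave c y r + wave (- c) y r to be proportional to r. *)
Let wave_r c y z : c * c^* = 1 -> wave c y r z = wave c y p 0 * r z.
Proof.
move=> c1; have c1' : (- c) * (- c)^* = 1 by rewrite rmorphN mulrNN.
have sp := sqnorm_wave_le y c1; have sm := sqnorm_wave_le y c1'.
set s := cRe (wave c y p 0) in sp *; set s' := cRe (wave (- c) y p 0) in sm *.
have ss : s + s' = 4.
  rewrite /s /s' -ReD (_ : _ + _ = 4 * p 0); last by rewrite /wave rmorphN; ring.
  by rewrite p0 mulr1 -[4]/(4%:R) -(rmorph_nat (real_complex R)).
have s0 : 0 <= s by have := wave_p_ge0 y c1; rewrite lecE => /andP[].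
have s'0 : 0 <= s' by have := wave_p_ge0 y c1'; rewrite lecE => /andP[].
pose d x := wave c y r x - s%:C%C * r x.
have cd : ccont d.
  rewrite /d (_ : (fun x => _) = fun x => wave c y r x + (- s%:C%C) * r x); last first.
    by apply/funext => x; rewrite mulNr.
  by apply: ccontD; [exact: ccont_wave|apply: ccontM => //; exact: ccont_cst].
have E1 : wave c y r = fun x => s%:C%C * r x + 1%:C%C * d x.
  by apply/funext => x; rewrite /d mul1r; ring.
have E2 : wave (- c) y r = fun x => s'%:C%C * r x + (-1)%:C%C * d x.
  have nE : (4 : R)%:C%C = 4 := rmorph_nat (real_complex R) 4.
  have NE : (-1 : R)%:C%C = -1 := rmorphN1 (real_complex R).
  have s'E : s'%:C%C = 4 - s%:C%C by rewrite -nE -rmorphB; congr (_%:C%C); lra.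
  by apply/funext => x; rewrite /d s'E NE /wave rmorphN; ring.
move: sp sm; rewrite E1 E2 !sqnorm_comb// sqnorm_r.
set X := cRe _ + cRe _; set D := sqnorm d => sp sm.
(* After cancelling the terms in [m], the bounds read [s * X + D <= 0] and [D - s' * X <= 0]; with
   weights [s'] and [s] the cross term [X] drops out. *)
have D0 : D <= 0.
  have h1 : s' * (s * X + D) <= 0 by apply: mulr_ge0_le0 => //; lra.
  have h2 : s * (D - s' * X) <= 0 by apply: mulr_ge0_le0 => //; lra.
  have : (s + s') * D <= 0 by lra.
  by rewrite ss; lra.
have := sqnorm_eq0 cd D0 z; rewrite /d => /eqP; rewrite subr_eq0 => /eqP ->.
by rewrite [in RHS](wave_pE y c1) subrr mulr0 addr0.
Qed.

(** For [c] equal to 1 and to ['i], [wave_r] says that the errors at [y] and at [- y] have sum 0 and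
    difference 0. *)
Let r_shift y z : r (z + y) = p y * r z.
Proof.
have E1 := @wave_r 1 y z; have E2 := @wave_r 'i%C y z.
move: E1 E2; rewrite /wave !rmorph1 !add0r p0 mulr1 => /(_ (mulr1 1)) E1.
have ii : 'i%C * ('i%C)^* = 1 :> R[i].
  by rewrite conjE; apply/eqP; rewrite eq_complex /=; apply/andP; split; apply/eqP; ring.
have iJ : ('i%C)^* = - 'i%C :> R[i].
  by rewrite conjE; apply/eqP; rewrite eq_complex /= oppr0 !eqxx.
move=> /(_ ii); rewrite iJ => E2.
have i0 : 'i%C != 0 :> R[i] by rewrite eq_complex /= oner_eq0 andbF.
set A := r (z + y) in E1 E2 *; set B := r (z - y) in E1 E2.
have H1 : (A - p y * r z) + (B - p (- y) * r z) = 0.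
  transitivity ((2 * r z + 1 * A + 1 * B) - (2 + 1 * p y + 1 * p (- y)) * r z).
    by ring.
  by rewrite E1 subrr.
have H2 : 'i%C * ((A - p y * r z) - (B - p (- y) * r z)) = 0.
  transitivity ((2 * r z + 'i%C * A + - 'i%C * B)
    - (2 + 'i%C * p y + - 'i%C * p (- y)) * r z); first by ring.
  by rewrite E2 subrr.
move/eqP: H2; rewrite mulf_eq0 (negbTE i0) /= => /eqP H2.
have : 2 * (A - p y * r z) = 0 by rewrite -[RHS](addr0 0) -{1}H1 -H2; ring.
by move/eqP; rewrite mulf_eq0 pnatr_eq0 /= subr_eq0 => /eqP.
Qed.

(** By [r_shift], [r] is [r 0] times [p], and it cannot vanish since [sqnorm r] is the positive
    number [m]. *)
Let r0_neq0 : r 0 != 0.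
Proof.
apply/eqP => r0; have : sqnorm r = 0.
  rewrite /sqnorm (_ : (fun x => _) = fun=> 0); first by rewrite cint_cst.
  by apply/funext => x; rewrite -[x]add0r r_shift r0 mulr0 mul0r.
by rewrite sqnorm_r => m0; move: m_gt0; rewrite m0 ltxx.
Qed.

Let pE x : p x = (r 0)^-1 * r x.
Proof. by rewrite -[in RHS](add0r x) r_shift mulrC mulfK. Qed.

Let pD x y : p (x + y) = p x * p y.
Proof. by rewrite !pE -[in LHS]/(_ * _) r_shift pE; ring. Qed.

(** As a limit of elements of [Q], [p] is bounded by 1, and [p x * p (- x) = 1] forces equality. *)
Let p_norm x : normc (p x) = 1.
Proof.
have le1 y : normc (p y) <= 1.
  rewrite leNgt; apply/negP => lt1; have e0 : 0 < normc (p y) - 1 by rewrite subr_gt0.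
  have [q [/(Q_le1 y) q1 hq]] := filter_ex (filterI U_Q (p_lim y e0)).
  have := normcD_le (p y - q y) (q y); rewrite subrK normcB.
  by move: hq => /=; lra.
have := pD x (- x); rewrite subrr p0 => /(congr1 (@normc R)); rewrite normcM normc1.
move=> h1; have := ler_wpM2l (normc_ge0 (p x)) (le1 (- x)); rewrite -h1 mulr1 => ge1.
by apply/eqP; rewrite eq_le le1 ge1.
Qed.

(** The character is [p]. If the coefficient of [h] at [p] were 0, so would be that of each
    [corr h q], and in the limit that of [r]; but [r] is [r 0] times [p], whose coefficient at [p]
    is [r 0]. *)
Lemma limit_character : exists theta : pontryagin_dual R G,
  cint (fun x => h x * (theta x)^*) != 0.
Proof.
have cp : ccont p.
  rewrite (_ : p = fun x => (r 0)^-1 * r x); last by apply/funext => x; exact: pE.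
  by apply: ccontM => //; exact: ccont_cst.
have p1 x : `|p x| = 1 by rewrite normcE p_norm.
exists (Character p1 pD (proj1 (ccontP p) cp)) => /=.
apply/eqP => hp.
have mhp : cmeas (fun x => h x * (p x)^*).
  by apply: ccont_cmeas => //; apply: ccontM => //; exact: ccontJ.
(* Exchanging the integrals factors this coefficient into that of [q] times the conjugate of that of
   [h]. *)
have corr_p q : Q q -> cint (fun z => corr h q z * (p z)^*) = 0.
  move=> Qq; have [_ cq _] := Qq.
  pose k z y := (h y)^* * q (z + y) * (p z)^*.
  have E z : corr h q z * (p z)^* = cint (k z).
    rewrite /corr -cintZr//; apply: ccont_cmeas => //; exact: corr_integrand.
  have cqp : cmeas (fun x => q x * (p x)^*).
    by apply: ccont_cmeas => //; apply: ccontM => //; exact: ccontJ.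
  have ky y : (fun z => k z y) = fun z => (h y)^* * p y * (q (z + y) * (p (z + y))^*).
    apply/funext => z; rewrite /k pD rmorphM /=.
    have : p y * (p y)^* = 1 by rewrite mulJ_normc p_norm expr1n.
    move=> py; rewrite -[LHS]mul1r -py; ring.
  have kyE y : cint (fun z => k z y) = cint (fun x => q x * (p x)^*) * (h y * (p y)^*)^*.
    rewrite ky cintZ; last exact: (cmeas_shift eta_inv y cqp).
    by rewrite (cint_shift eta_inv y cqp) rmorphM /= conjCK mulrC.
  rewrite (_ : (fun z => _) = fun z => cint (k z)); last by apply/funext.
  rewrite (cint_exchange Gc).
  - rewrite (_ : (fun y => _) = fun y => cint (fun x => q x * (p x)^*) * (h y * (p y)^*)^*).
      by rewrite cintZ ?cintJ ?hp ?conjC0 ?mulr0//; exact: cmeasJ.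
    by apply/funext.
  - move=> z; apply: ccont_cmeas => //; apply: ccontM; last exact: ccont_cst.
    exact: corr_integrand.
  - move=> y; rewrite ky; apply: cmeasZ; exact: (cmeas_shift eta_inv y cqp).
  - rewrite (_ : (fun z => _) = fun z => corr h q z * (p z)^*); last by apply/funext.
    apply: ccont_cmeas => //; apply: ccontM; last exact: ccontJ.
    exact: corr_ccont.
  - rewrite (_ : (fun y => _) = fun y => cint (fun x => q x * (p x)^*) * (h y * (p y)^*)^*).
      by apply: cmeasZ; exact: cmeasJ.
    by apply/funext.
  - move=> e e0; have [kh hk] := ccont_bounded Gc ch.
    have kh0 : 0 <= kh by rewrite (le_trans (normc_ge0 (h 0))).
    have d0 : 0 < e / (kh + 1) by rewrite divr_gt0// ltr_wpDl.
    have qpu := ccont_unif Gc (ccontM cq (ccontJ cp)) d0.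
    apply: filterS qpu => v hv z y.
    have kE z' : k z' y = (h y)^* * p y * (q (z' + y) * (p (z' + y))^*).
      by have := congr1 (fun f => f z') (ky y).
    rewrite !kE -mulrBr !normcM normcJ_eq p_norm mulr1.
    rewrite (_ : z + v + y = z + y + v); last by rewrite addrAC.
    apply: (@le_trans _ _ ((kh + 1) * (e / (kh + 1)))).
      rewrite ler_pM ?normc_ge0//; first by rewrite (le_trans (hk y))// lerDl.
      exact/ltW/hv.
    by rewrite mulrC divfK// gt_eqF// ltr_wpDl.
have [kr rk] := ccont_bounded Gc cr.
(* [utendsM] takes one bound for both factors; [kr + 1] bounds [r] and also the modulus 1 of [p]. *)
have kr1 x : normc (r x) <= kr + 1 by rewrite (le_trans (rk x))// lerDl.
have kr0 : 0 <= kr by rewrite (le_trans (normc_ge0 (r 0))).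
have lim : tends U (fun q => cint (fun z => corr h q z * (p z)^*))
    (cint (fun z => r z * (p z)^*)).
  apply: utends_cint.
  - apply: filterS near_corr => q cq; apply: ccont_cmeas => //.
    by apply: ccontM => //; exact: ccontJ.
  - by apply: ccont_cmeas => //; apply: ccontM => //; exact: ccontJ.
  - apply: (@utendsM _ _ _ _ UU _ _ _ _ (kr + 1)) => //.
      by move=> x; rewrite normcJ_eq p_norm lerDr.
    exact: (@utends_cst _ _ _ _ UU).
have z0 : tends U (fun=> 0 : R[i]) (cint (fun z => r z * (p z)^*)).
  by apply: tends_near lim; apply: filterS U_Q => q; exact: corr_p.
have r00 : tends U (fun=> 0 : R[i]) 0 by exact: tends_cst.
have := tends_unique z0 r00.
rewrite (_ : (fun z => _) = fun=> r 0); last first.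
  apply/funext => z; rewrite -[z in r z]add0r r_shift mulrAC mulJ_normc p_norm.
  by rewrite expr1n mul1r.
by rewrite cint_cst => r_0; move: r0_neq0; rewrite r_0 eqxx.
Qed.

End Limit.

Lemma posdef_character : exists theta : pontryagin_dual R G,
  cint (fun x => h x * (theta x)^*) != 0.
Proof.
have [U [UU sub]] := ultraFilterLemma near_max_proper.
exact: (limit_character UU sub).
Qed.

End Maximizer.

End CharacterExistence.

(** * Fourier coefficients *)

Section FourierCompleteness.
Variables (R : realType) (G : topologicalZmodType).
Hypothesis Gc : compact [set: G].
Hypothesis Gh : hausdorff_space G.
Variable eta : probability (borelType G) R.
Hypothesis eta_haar : normalised_haar eta.
Implicit Types (q F : G -> R[i]) (c : R[i]) (theta : pontryagin_dual R G).
Local Notation cint := (cint eta).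
Local Notation rint := (rint eta).

Let eta_inv : translation_invariant eta. Proof. by case: eta_haar. Qed.
Let eta_outer : outer_regular eta. Proof. by case: eta_haar. Qed.
Let eta_inner : open_inner_regular eta. Proof. by case: eta_haar. Qed.

Lemma char_ccont theta : ccont theta.
Proof. by apply/ccontP; exact: char_continuous. Qed.

Lemma char_normc theta x : normc (theta x) = 1.
Proof. by have := char_norm theta x; rewrite normcE => -[]. Qed.

Lemma char_mulJ theta x : theta x * (theta x)^* = 1.
Proof. by rewrite mulJ_normc char_normc expr1n. Qed.

Lemma char0 theta : theta 0 = 1.
Proof.
have t0 : theta 0 != 0.
  by apply/eqP => t0; have := char_normc theta 0; rewrite t0 normc0 => /eqP; rewrite eq_sym oner_eq0.
by apply: (mulfI t0); rewrite -char_mul addr0 mulr1.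
Qed.

Lemma char_eq (theta theta' : pontryagin_dual R G) : theta =1 theta' -> theta = theta'.
Proof.
case: theta theta' => [f fn fm fc] [k kn km kc] /= /funext fk; subst k.
by congr Character; exact: Prop_irrelevance.
Qed.

Definition autocorr F (z : G) : R[i] := cint (fun y => F (z + y) * (F y)^*).

Lemma cmeas_shiftl z F : cmeas F -> cmeas (fun y => F (z + y)).
Proof.
move=> mF; rewrite (_ : (fun y => _) = fun y => F (y + z)); first exact: (cmeas_shift eta_inv).
by apply/funext => y; rewrite addrC.
Qed.

(** After a translation by [x j] in each term, the quadratic form becomes the integral of
    [|W|^2]. *)
Lemma autocorr_posdef F : cmeas F -> posdef (autocorr F).
Proof.
move=> mF n x a; have mxF i := cmeas_shiftl (x i) mF.
pose W y := \sum_(i < n) a i * F (x i + y).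
have mW : cmeas W by apply: cmeas_sum => i; exact: cmeasZ.
suff -> : \sum_(i < n) \sum_(j < n) a i * (a j)^* * autocorr F (x i - x j) =
    cint (fun y => W y * (W y)^*).
  by apply: cint_ge0 => [|y]; [apply: cmeasM => //; exact: cmeasJ|rewrite mulJ_normc lecR sqr_ge0].
have mij i j : cmeas (fun y => F (x i + y) * (F (x j + y))^*).
  by apply: cmeasM => //; exact: cmeasJ.
rewrite (_ : (fun y => _) = fun y => \sum_(i < n) \sum_(j < n)
    a i * (a j)^* * (F (x i + y) * (F (x j + y))^*)); last first.
  apply/funext => y; rewrite /W mulr_suml; apply: eq_bigr => i _.
  rewrite rmorph_sum /= mulr_sumr; apply: eq_bigr => j _; rewrite rmorphM /=; ring.
rewrite cint_sum; last by move=> i; apply: cmeas_sum => j; exact: cmeasZ.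
apply: eq_bigr => i _; rewrite cint_sum; last by move=> j; exact: cmeasZ.
apply: eq_bigr => j _; rewrite cintZ//; congr (_ * _).
have m0 : cmeas (fun y => F (x i - x j + y) * (F y)^*).
  by apply: cmeasM; [exact: cmeas_shiftl|exact: cmeasJ].
rewrite /autocorr -(cint_shift eta_inv (x j) m0); congr cint; apply/funext => y.
by rewrite [y + x j]addrC addrA subrK.
Qed.

(** The autocorrelation of [F] with its second factor replaced by [phi]; a continuous [phi] makes it
    continuous and amenable to [cint_exchange]. *)
Definition mixedcorr F phi (z : G) : R[i] := cint (fun y => F y * (phi (y - z))^*).

Lemma cmeas_bounded F : cmeas F -> exists2 k, 0 <= k & forall x, normc (F x) <= k.
Proof.
move=> [[_ [k1 h1]] [_ [k2 h2]]]; exists (k1 + k2) => [|x].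
  by rewrite addr_ge0// (le_trans (normr_ge0 _) (h1 0), le_trans (normr_ge0 _) (h2 0)).
by rewrite (le_trans (normc_le _))// lerD// ?h1 ?h2.
Qed.

Lemma mixedcorr_cmeas F phi z : cmeas F -> ccont phi ->
  cmeas (fun y => F y * (phi (y - z))^*).
Proof.
by move=> mF cphi; apply: cmeasM => //; apply: ccont_cmeas => //; apply: ccontJ; exact: ccont_shift.
Qed.

Lemma mixedcorr_ccont F phi : cmeas F -> ccont phi -> ccont (mixedcorr F phi).
Proof.
move=> mF cphi x e e0; have [k k0 Fk] := cmeas_bounded mF.
have d0 : 0 < e / (2 * (k + 1)) by rewrite divr_gt0// mulr_gt0// ltr_wpDl.
apply: filterS (near_sub x (ccont_unif Gc cphi d0)) => y hv.
rewrite /mixedcorr -cintB; [|exact: mixedcorr_cmeas..].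
apply: (@le_lt_trans _ _ (2 * (k * (e / (2 * (k + 1)))))).
  apply: cint_norm_le_cst; first by apply: cmeasB; exact: mixedcorr_cmeas.
  move=> w; rewrite -mulrBr normcM ler_pM ?normc_ge0//.
  rewrite -rmorphB normcJ_eq normcB; have := hv (w - y).
  by rewrite addrA subrK => /ltW.
rewrite (_ : 2 * _ = e * (k / (k + 1))); last by field; lra.
by rewrite gtr_pMr// ltr_pdivrMr ?mul1r ?ltrDl// ltr_wpDl.
Qed.

(* Fubini for a Borel function and a continuous one; the Borel sigma-algebra of
   [G * G] may exceed the product one, so two Borel functions are out of reach. *)
Lemma mixedcorr_fourier F phi theta : cmeas F -> ccont phi ->
  cint (fun x => F x * (theta x)^*) = 0 ->
  cint (fun z => mixedcorr F phi z * (theta z)^*) = 0.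
Proof.
move=> mF cphi Ft; have ct := char_ccont theta.
(* Splitting [theta z] as [theta (z - y) * theta y] makes the kernel a product of a function of [y]
   and a continuous function of [z - y]. *)
pose g w := phi (- w) * theta w.
have cg : ccont g by apply: ccontM => //; exact: ccont_opp.
have mt : cmeas (fun x => F x * (theta x)^*).
  by apply: cmeasM => //; apply: cmeasJ; exact: ccont_cmeas.
pose k z y := F y * (theta y)^* * (g (z - y))^*.
have kE z y : F y * (phi (y - z))^* * (theta z)^* = k z y.
  have -> : theta z = theta (z - y) * theta y by rewrite -char_mul subrK.
  by rewrite /k /g opprB !rmorphM /=; ring.
have mg y : cmeas (fun z => (g (z - y))^*).
  by apply: ccont_cmeas => //; apply: ccontJ; exact: ccont_shift.
have kz z : mixedcorr F phi z * (theta z)^* = cint (k z).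
  rewrite -cintZr; last exact: mixedcorr_cmeas.
  by congr cint; apply/funext => y; exact: kE.
have ky y : cint (fun z => k z y) = cint (fun w => (g w)^*) * (F y * (theta y)^*).
  rewrite cintZ// mulrC; congr (_ * _).
  have mg0 : cmeas (fun w => (g w)^*) by apply: ccont_cmeas => //; exact: ccontJ.
  by rewrite -(cint_shift eta_inv (- y) mg0).
rewrite (_ : (fun z => _) = fun z => cint (k z)); last by apply/funext.
rewrite (cint_exchange Gc).
- rewrite (_ : (fun y => _) = fun y => cint (fun w => (g w)^*) * (F y * (theta y)^*)).
    by rewrite cintZ// Ft mulr0.
  by apply/funext.
- move=> z; rewrite (_ : k z = fun y => F y * (phi (y - z))^* * (theta z)^*).
    by apply: cmeasM; [exact: mixedcorr_cmeas|exact: cmeas_cst].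
  by apply/funext => y; rewrite kE.
- by move=> y; apply: cmeasZ.
- rewrite (_ : (fun z => _) = fun z => mixedcorr F phi z * (theta z)^*).
    apply: ccont_cmeas => //; apply: ccontM; last exact: ccontJ.
    exact: mixedcorr_ccont.
  by apply/funext.
- rewrite (_ : (fun y => _) = fun y => cint (fun w => (g w)^*) * (F y * (theta y)^*)).
    exact: cmeasZ.
  by apply/funext.
- move=> e e0; have [K K0 FK] := cmeas_bounded mt.
  have d0 : 0 < e / (K + 1) by rewrite divr_gt0// ltr_wpDl.
  apply: filterS (ccont_unif Gc cg d0) => v hv z y.
  rewrite /k -mulrBr normcM -rmorphB normcJ_eq addrAC.
  apply: (@le_trans _ _ ((K + 1) * (e / (K + 1)))).
    rewrite ler_pM ?normc_ge0//; first by rewrite (le_trans (FK y))// lerDl.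
    exact/ltW/hv.
  by rewrite mulrC divfK// gt_eqF// ltr_wpDl.
Qed.

(** * Autocorrelation of bounded functions approximable in mean by continuous ones *)

Section L1Approximable.
Variables (F : G -> R[i]) (k : R).
Hypothesis mF : cmeas F.
Hypothesis Fk : forall x, normc (F x) <= k.
Hypothesis F_approx : forall e : R, 0 < e -> exists phi, ccont phi /\
  bmeas (fun x => normc (F x - phi x)) /\ rint (fun x => normc (F x - phi x)) <= e.

Let autocorrE z : autocorr F z = cint (fun y => F y * (F (y - z))^*).
Proof.
have m0 : cmeas (fun y => F (z + y) * (F y)^*).
  by apply: cmeasM; [exact: cmeas_shiftl|exact: cmeasJ].
rewrite /autocorr -(cint_shift eta_inv (- z) m0); congr cint; apply/funext => y.
by rewrite [y - z]addrC addrA subrr add0r.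
Qed.

(** The estimate is uniform in [z] because the mean distance from [F] to [phi] is invariant under
    translation. *)
Let autocorr_approx (e : R) : 0 < e -> exists phi, ccont phi /\
  forall z, normc (autocorr F z - mixedcorr F phi z) <= e.
Proof.
move=> e0; have k0 : 0 <= k by rewrite (le_trans (normc_ge0 (F 0))).
have d0 : 0 < e / (2 * (k + 1)) by rewrite divr_gt0// mulr_gt0// ltr_wpDl.
have [phi [cphi [bphi iphi]]] := F_approx d0; exists phi; split => // z.
have mJ : cmeas (fun y => F y * (F (y - z))^*).
  by apply: cmeasM => //; apply: cmeasJ; exact: (cmeas_shift eta_inv).
rewrite autocorrE /mixedcorr -cintB//; last exact: mixedcorr_cmeas.
pose D x := normc (F x - phi x).
have bD : bmeas (fun y => D (y - z)) /\ rint (fun y => D (y - z)) = rint D.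
  have [[b1 _] /(congr1 (@complex.Re R))] := cint_comp
    (continuous_borel (@addr_continuous G (- z))) (shift_invariant eta_inv (- z)) (cmeas_real bphi).
  by rewrite /= => E; split.
have [bDz rD] := bD.
apply: (@le_trans _ _ (2 * rint (fun y => k * D (y - z)))).
  apply: cint_norm_le.
  - by apply: cmeasB => //; exact: mixedcorr_cmeas.
  - by apply: bmeasM => //; exact: bmeas_cst.
  - move=> y; rewrite -mulrBr normcM ler_pM ?normc_ge0//.
    by rewrite -rmorphB normcJ_eq.
rewrite rintZ// rD (@le_trans _ _ (2 * (k * (e / (2 * (k + 1))))))//.
  by rewrite ler_wpM2l// ler_wpM2l.
rewrite (_ : 2 * _ = e * (k / (k + 1))); last by field; lra.
by rewrite ger_pMr// ler_pdivrMr ?mul1r ?lerDl// ltr_wpDl.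
Qed.

Lemma autocorr_ccont : ccont (autocorr F).
Proof.
move=> x e e0; have e3 : 0 < e / 3 by rewrite divr_gt0.
have [phi [cphi h]] := autocorr_approx e3.
apply: filterS (mixedcorr_ccont mF cphi x e3) => y hy.
have := normc_dist (autocorr F y) (mixedcorr F phi y) (autocorr F x).
have := normc_dist (mixedcorr F phi y) (mixedcorr F phi x) (autocorr F x).
have := h x; have := h y; rewrite (normcB (autocorr F x)).
move: hy; lra.
Qed.

Lemma autocorr_fourier theta : cint (fun x => F x * (theta x)^*) = 0 ->
  cint (fun z => autocorr F z * (theta z)^*) = 0.
Proof.
move=> Ft; have ct := char_ccont theta; apply: (@small_eq0 _ _ 2) => e e0.
have [phi [cphi h]] := autocorr_approx e0.
have mt H : ccont H -> cmeas (fun z => H z * (theta z)^*).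
  by move=> cH; apply: ccont_cmeas => //; apply: ccontM => //; exact: ccontJ.
rewrite -[X in normc X]subr0 -(mixedcorr_fourier mF cphi Ft) -cintB; last first.
- exact/mt/mixedcorr_ccont.
- exact/mt/autocorr_ccont.
apply: cint_norm_le_cst.
  by apply: cmeasB; apply: mt; [exact: autocorr_ccont|exact: mixedcorr_ccont].
by move=> z; rewrite -mulrBl normcM normcJ_eq char_normc mulr1.
Qed.

(** The integral of [|F|^2] is the value at 0 of the autocorrelation. If it is nonzero,
    [posdef_character] yields a character at which the autocorrelation has a nonzero coefficient,
    against [autocorr_fourier]. *)
Lemma fourier_complete : (forall theta, cint (fun x => F x * (theta x)^*) = 0) ->
  cint (fun x => F x * (F x)^*) = 0.
Proof.
move=> Ft; apply: contrapT => /eqP F0.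
have h0 : autocorr F 0 != 0.
  rewrite /autocorr (_ : (fun y => _) = fun x => F x * (F x)^*)//.
  by apply/funext => y; rewrite add0r.
have [theta] := posdef_character Gc eta_inv autocorr_ccont (autocorr_posdef mF) h0.
by rewrite autocorr_fourier// eqxx.
Qed.

End L1Approximable.

(** Translation by a point [x] where the characters differ multiplies the integral by a constant
    other than 1, yet leaves it unchanged. *)
Lemma char_orthogonal theta theta' : theta <> theta' ->
  cint (fun x => theta x * (theta' x)^*) = 0.
Proof.
move=> tt'; have [x txt'] : exists x, theta x != theta' x.
  by apply: contrapT => /forallNP h; apply: tt'; apply: char_eq => x; apply/eqP/negPn/negP/h.
have m0 : cmeas (fun x => theta x * (theta' x)^*).
  by apply: ccont_cmeas => //; apply: ccontM; [|apply: ccontJ]; exact: char_ccont.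
have := cint_shift eta_inv x m0.
rewrite (_ : (fun y => _) = fun y => theta x * (theta' x)^* * (theta y * (theta' y)^*)); last first.
  by apply/funext => y; rewrite !char_mul rmorphM /=; ring.
rewrite cintZ// => /eqP; rewrite -subr_eq0 -[X in _ - X]mul1r -mulrBl mulf_eq0 subr_eq0.
case/orP => /eqP// E; case/eqP: txt'.
by rewrite -[LHS]mulr1 -(char_mulJ theta' x) [theta' x * _]mulrC mulrA E mul1r.
Qed.

Lemma bessel_step F theta (a : R[i]) : cmeas F -> cint (fun x => F x * (theta x)^*) = a ->
  cint (fun x => (F x - a * theta x) * (F x - a * theta x)^*) =
  cint (fun x => F x * (F x)^*) - a * a^*.
Proof.
move=> mF Fa; have mt := ccont_cmeas Gc (@char_ccont theta).
have m1 : cmeas (fun x => F x * (F x)^*) by apply: cmeasM => //; exact: cmeasJ.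
have m2 : cmeas (fun x => F x * (theta x)^*) by apply: cmeasM => //; exact: cmeasJ.
have m3 : cmeas (fun x => a^* * (F x * (theta x)^*) + a * (F x * (theta x)^*)^* - a * a^*).
  apply: cmeasB; last exact: cmeas_cst.
  by apply: cmeasD; apply: cmeasZ => //; exact: cmeasJ.
rewrite (_ : (fun x => (F x - _) * _) = fun x => F x * (F x)^* -
    (a^* * (F x * (theta x)^*) + a * (F x * (theta x)^*)^* - a * a^*)); last first.
  apply/funext => x; rewrite rmorphB !rmorphM /= conjCK -[X in _ - (_ - X)](mulr1) -(char_mulJ theta x).
  ring.
rewrite cintB//; congr (_ - _).
rewrite cintB; [|by apply: cmeasD; apply: cmeasZ => //; exact: cmeasJ|exact: cmeas_cst].
rewrite cintD; [|exact: cmeasZ|by apply: cmeasZ; exact: cmeasJ].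
rewrite cint_cst !cintZ//; last exact: cmeasJ.
by rewrite cintJ// Fa; ring.
Qed.

(** Removing the components along the first [n] characters lowers the integral of [|F|^2] by [n]
    times [|a|^2], and the remainder stays nonnegative for every [n]. *)
Lemma bessel_constant F (theta : nat -> pontryagin_dual R G) (a : R[i]) : cmeas F ->
  injective theta -> (forall n, cint (fun x => F x * (theta n x)^*) = a) -> a = 0.
Proof.
move=> mF tinj Fa.
(* By orthogonality the coefficients at the characters not yet removed are still [a]. *)
have step n : exists Fn, [/\ cmeas Fn,
    forall k, (n <= k)%N -> cint (fun x => Fn x * (theta k x)^*) = a
    & cint (fun x => Fn x * (Fn x)^*) = cint (fun x => F x * (F x)^*) - n%:R * (a * a^*)].
  elim: n => [|n [Fn [mn an In]]]; first by exists F; split => //; rewrite mul0r subr0.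
  have mt k := ccont_cmeas Gc (@char_ccont (theta k)).
  exists (fun x => Fn x - a * theta n x); split.
  - by apply: cmeasB => //; exact: cmeasZ.
  - move=> k nk; rewrite (_ : (fun x => _) = fun x => Fn x * (theta k x)^* -
        a * (theta n x * (theta k x)^*)); last by apply/funext => x; ring.
    have mtk : cmeas (fun x => theta n x * (theta k x)^*).
      by apply: cmeasM => //; exact: cmeasJ.
    rewrite cintB; [|by apply: cmeasM => //; exact: cmeasJ|exact: cmeasZ].
    rewrite cintZ// an; last exact: ltnW.
    rewrite char_orthogonal ?mulr0 ?subr0// => /tinj nk'.
    by move: nk; rewrite nk' ltnn.
  - by rewrite bessel_step// ?an// In -natr1; ring.
have reI n : n%:R * (normc a) ^+ 2 <= cRe (cint (fun x => F x * (F x)^*)).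
  have [Fn [mn _ In]] := step n.
  have : 0 <= cint (fun x => Fn x * (Fn x)^*).
    apply: cint_ge0; first by apply: cmeasM => //; exact: cmeasJ.
    by move=> x; rewrite mulJ_normc lecR sqr_ge0.
  rewrite In subr_ge0 mulJ_normc lecE => /andP[_].
  by rewrite -(rmorph_nat (real_complex R)) -rmorphM.
apply: eq0_normc; apply/eqP; rewrite eq_le normc_ge0 andbT leNgt; apply/negP => a0.
have a2 : 0 < normc a ^+ 2 by rewrite exprn_gt0.
set I := cRe _ in reI.
have := reI (Num.truncn (I / normc a ^+ 2)).+1.
rewrite -ler_pdivlMr// leNgt => /negP; apply.
exact: truncnS_gt.
Qed.

End FourierCompleteness.

(** * Ergodicity *)

HB.instance Definition _ (R : realType) (G : topologicalZmodType) :=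
  gen_eqMixin (pontryagin_dual R G).
HB.instance Definition _ (R : realType) (G : topologicalZmodType) :=
  gen_choiceMixin (pontryagin_dual R G).

Section Ergodicity.
Variables (R : realType) (G : topologicalZmodType).
Hypothesis Gc : compact [set: G].
Hypothesis Gh : hausdorff_space G.
Variable eta : probability (borelType G) R.
Hypothesis eta_haar : normalised_haar eta.
Implicit Types (theta : pontryagin_dual R G).
Local Notation cint := (cint eta).
Local Notation rint := (rint eta).

Let eta_inv : translation_invariant eta. Proof. by case: eta_haar. Qed.
Let eta_outer : outer_regular eta. Proof. by case: eta_haar. Qed.
Let eta_inner : open_inner_regular eta. Proof. by case: eta_haar. Qed.

Definition centered_indic (B : set G) (x : G) : R[i] := (\1_B x - rint (\1_B))%:C%C.

Section CenteredIndicator.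
Variable B : set (borelType G).
Hypothesis mB : measurable B.
Local Notation f := (centered_indic B).
Local Notation b := (rint (\1_B)).

Let bB : bmeas (\1_B : G -> R). Proof. exact: bmeas_indic. Qed.

Let bf : bmeas (fun x => \1_B x + - b).
Proof. by apply: bmeasD => //; exact: bmeas_cst. Qed.

Lemma centered_indic_cmeas : cmeas f.
Proof. exact: cmeas_real. Qed.

Lemma rint_indic01 : 0 <= b <= 1.
Proof.
apply/andP; split.
  rewrite -[X in X <= _](rint_cst eta 0); by apply: rint_le => //; exact: bmeas_cst.
rewrite -[X in _ <= X](rint_cst eta 1); by apply: rint_le => //; exact: bmeas_cst.
Qed.

Lemma centered_indic_le1 x : normc (f x) <= 1.
Proof.
rewrite normc_real indicE; have /andP[b0 b1] := rint_indic01.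
by case: (_ \in _) => /=; rewrite ler_norml; apply/andP; split; lra.
Qed.

Lemma centered_indic_approx (e : R) : 0 < e -> exists phi, ccont phi /\
  bmeas (fun x => normc (f x - phi x)) /\ rint (fun x => normc (f x - phi x)) <= e.
Proof.
move=> e0; have [phi [cphi bphi _ iphi]] := approx_indic Gc Gh eta_outer eta_inner mB e0.
exists (fun x => (phi x)%:C%C + (- b)%:C%C); split.
  by apply: ccontD => //; exact: ccont_cst.
have -> : (fun x => normc (f x - ((phi x)%:C%C + (- b)%:C%C))) = fun x => `|\1_B x - phi x|.
  apply/funext => x; rewrite -normc_real; congr normc.
  by rewrite /centered_indic !rmorphB rmorphN /=; ring.
split => //; have [m1 [k1 h1]] := bmeasD bB (bmeasN bphi).
split; last by exists k1 => x; rewrite normr_id.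
by apply: measurableT_comp.
Qed.

Lemma centered_indic_mean : cint f = 0.
Proof. by rewrite /centered_indic cint_real rintD ?rint_cst ?subrr//; exact: bmeas_cst. Qed.

Lemma centered_indic_sqr : cint (fun x => f x * (f x)^*) = (b - b ^+ 2)%:C%C.
Proof.
rewrite (_ : (fun x => _) = fun x => ((1 - 2 * b) * \1_B x + b ^+ 2)%:C%C); last first.
  apply/funext => x; rewrite mulJ_normc normc_real real_normK ?num_real//.
  by congr (_%:C%C); rewrite indicE; case: (_ \in _) => /=; ring.
rewrite cint_real rintD; [|by apply: bmeasM => //; exact: bmeas_cst|exact: bmeas_cst].
by rewrite rintZ// rint_cst; congr (_%:C%C); ring.
Qed.

End CenteredIndicator.

Lemma infinite_orbits_ergodic (Gamma : set (cAut G)) :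
  (forall theta, theta <> trivial_char R G -> infinite_set (char_orbit Gamma theta)) ->
  ergodic Gamma eta.
Proof.
move=> inf B mB invB; have mf := centered_indic_cmeas mB.
set f := centered_indic B in mf.
have f_inv g x : Gamma g -> f (g^-1%g x) = f x.
  move=> /invB gB; rewrite /f /centered_indic !indicE.
  suff -> : (g^-1%g x \in B) = (x \in B) by [].
  apply/idP/idP; rewrite !inE => Bx.
    by rewrite -gB; exists (g^-1%g x) => //; exact: cAut_invK.
  by move: Bx; rewrite -{1}gB => -[y By <-]; rewrite /= cAut_funK.
(* Both [f] and the integral are invariant under the inverse of [g]. *)
have orbit theta g : Gamma g -> cint (fun x => f x * (act_char g theta x)^*) =
    cint (fun x => f x * (theta x)^*).
  move=> Gg; have mt : cmeas (fun x => f x * (theta x)^*).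
    by apply: cmeasM => //; apply: cmeasJ; apply: ccont_cmeas => //; exact: char_ccont.
  rewrite -(cint_aut Gc eta_inv Gh eta_outer eta_inner g^-1%g mt); congr cint.
  by apply/funext => x /=; rewrite f_inv.
have ft theta : cint (fun x => f x * (theta x)^*) = 0.
  have [->|ntheta] := pselect (theta = trivial_char R G).
    rewrite -[RHS](centered_indic_mean mB); congr cint.
    by apply/funext => x; rewrite /= conjC1 mulr1.
  (* The infinite orbit contains an injective sequence of characters, all with the same coefficient,
     so [bessel_constant] applies. *)
  have /infiniteP/card_leP/unsquash u := inf _ ntheta.
  pose chi n := val (u (SigSub (mem_setT n))).
  have chi_orbit n : char_orbit Gamma theta (chi n) by exact: set_valP.
  apply: (@bessel_constant _ _ Gc eta eta_haar f chi) => //.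
    move=> n k /val_inj nk; have := @inj _ _ _ u (SigSub (mem_setT n)) (SigSub (mem_setT k)).
    by rewrite !inE => /(_ I I nk) [].
  by move=> n; have [g Gg <-] := chi_orbit n; exact: orbit.
(* With all its coefficients 0, [f] has square integral 0; this integral is [b - b ^+ 2], so [b] is
   0 or 1. *)
have := fourier_complete Gc eta_haar mf (centered_indic_le1 mB)
  (centered_indic_approx mB) ft.
rewrite centered_indic_sqr// => -[].
rewrite (probE eta mB); set b := rint _ => bb.
have /eqP : b * (1 - b) = 0 by rewrite -bb; ring.
rewrite mulf_eq0 => /orP[/eqP->|]; first by left.
by rewrite subr_eq0 => /eqP <-; right.
Qed.

Lemma ergodic_infinite_orbits (Gamma : set (cAut G)) : is_subgroup Gamma ->
  ergodic Gamma eta ->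
  forall theta, theta <> trivial_char R G -> infinite_set (char_orbit Gamma theta).
Proof.
move=> [Gamma1 GammaV] erg theta ntheta fin.
rewrite inE in Gamma1.
have GammaDiv g k : Gamma g -> Gamma k -> Gamma (g * k^-1)%g.
  by move=> Gg Gk; have := GammaV g k; rewrite !inE; apply.
have [x0 tx0] : exists x, theta x != 1.
  by apply: contrapT => /forallNP h; apply: ntheta; apply: char_eq => x; apply/eqP/negPn/negP/h.
(* With half the distance, [x0] lies in [V] below, while [theta], a member of its own orbit, is
   within [e] of 1 on [U]; hence [U] and [V] are disjoint. *)
set e := normc (theta x0 - 1) / 2.
have e0 : 0 < e.
  rewrite divr_gt0// lt_neqAle normc_ge0 andbT eq_sym.
  by apply: contra tx0 => /eqP/eq0_normc/eqP; rewrite subr_eq0.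
pose U := [set x | forall chi, char_orbit Gamma theta chi -> normc (chi x - 1) < e].
have theta_orbit : char_orbit Gamma theta theta.
  by exists 1%g => //; apply: char_eq => x.
(* Finiteness of the orbit enters here: the complement is a finite union of closed sets. *)
have oU : open U.
  rewrite -closedC (_ : ~` U = \bigcup_(chi in char_orbit Gamma theta)
      ~` [set x | normc (chi x - 1) < e]).
    apply: closed_bigcup => // chi _; apply: open_closedC; apply: ccont_open.
    exact: char_ccont.
  rewrite -setC_bigcap; congr (~` _).
have U0 : U !=set0 by exists 0 => chi _; rewrite char0 subrr normc0.
pose V := [set x | e < normc (theta x - 1)].
have oV : open V by apply: ccont_open_gt; exact: char_ccont.
have V0 : V !=set0.
  exists x0; suff : e < normc (theta x0 - 1) by [].
  by move: e0; rewrite /e; lra.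
have orbit_act g chi : Gamma g -> char_orbit Gamma theta chi ->
    char_orbit Gamma theta (act_char g chi).
  move=> Gg [k Gk <-]; exists (g * k)%g; last exact: char_eq.
  (* The product comes from closure under quotients, as [g * (1 * k^-1)^-1]. *)
  have := GammaDiv _ _ Gg (GammaDiv _ _ Gamma1 Gk).
  by rewrite mul1g invgK.
have invU : invariant_set Gamma U.
  move=> g Gg; have GgV : Gamma g^-1%g by rewrite -[g^-1%g]mul1g; exact: GammaDiv.
  apply/seteqP; split=> [_ [x Ux <-] chi chio|x Ux].
    exact: Ux _ (orbit_act _ _ GgV chio).
  exists (g^-1%g x); last exact: cAut_invK.
  by move=> chi chio; exact: Ux _ (orbit_act _ _ Gg chio).
have mU : measurable (U : set (borelType G)) by exact: open_borel.
have mV : measurable (V : set (borelType G)) by exact: open_borel.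
have pU := open_measure_gt0 Gc eta_inv oU U0.
have pV := open_measure_gt0 Gc eta_inv oV V0.
(* Disjointness bounds the sum of the two measures by 1; both being positive, [U] is neither null
   nor conull. *)
have : rint (fun x => \1_U x + \1_V x) <= rint (fun=> 1).
  apply: rint_le; [by apply: bmeasD; exact: bmeas_indic|exact: bmeas_cst|move=> x].
  rewrite !indicE.
  have [xU|_] := boolP (x \in U); have [xV|_] := boolP (x \in V) => /=; try lra.
  move: xU xV; rewrite !inE => /(_ _ theta_orbit) h1 h2.
  by have := lt_trans h1 h2; rewrite ltxx.
rewrite rintD; [|exact: bmeas_indic..]; rewrite rint_cst.
case: (erg U mU invU); rewrite (probE eta mU) => -[]; move: pU pV; lra.
Qed.

End Ergodicity.

Theorem theorem3p1 (R : realType) (G : topologicalZmodType)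
    (G_hausdorff : hausdorff_space G) (G_compact : compact [set: G])
    (eta : probability (borelType G) R) (eta_haar : normalised_haar eta)
    (Gamma : set (cAut G)) (Gamma_group : is_subgroup Gamma) :
  ergodic Gamma eta <->
  (forall theta : pontryagin_dual R G, theta <> trivial_char R G ->
     infinite_set (char_orbit Gamma theta)).
Proof.
split; first exact: ergodic_infinite_orbits.
exact: infinite_orbits_ergodic.
Qed.
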